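(* Let $(S,d)$ be a separable and complete metric space. The Wasserstein metric metrizes the contractive approach structure, i.e. $\mathcal{A}_\kappa = \mathcal{A}_W$ as approach structures on $\mathcal{P}^1(S)$; equivalently, for each net $(P_\eta)_\eta$ in $\mathcal{P}^1(S)$ and each $P \in \mathcal{P}^1(S)$, the limit operators satisfy $$\lambda_\kappa(P_\eta \rightarrow P) = \lambda_{W}(P_\eta \rightarrow P),$$ or, more explicitly, $$\sup_{f \in \kappa(S,\mathbb{R})} \limsup_{\eta} \left|\int_S f\, dP - \int_S f\, dP_\eta\right| = \limsup_{\eta} \sup_{f \in \kappa(S,\mathbb{R})} \left|\int_S f\, dP - \int_S f\, dP_\eta\right|.$$
   Context: Approach theory. Let $X$ be a non-empty set. A collection $\mathcal{A}_0 \subset [0,\infty]^X$ is upwards-directed iff for all $\phi_1,\phi_2\in\mathcal{A}_0$ there is $\phi\in\mathcal{A}_0$ with $\max\{\phi_1,\phi_2\}\le\phi$ pointwise. A functional ideal on $X$ is an upwards-directed collection $\mathcal{A}_0 \subset [0,\infty]^X$ such that every $\phi\in[0,\infty]^X$ with the property ''for all $\varepsilon>0$ and $\omega<\infty$ there is $\phi_0\in\mathcal{A}_0$ with $\min\{\phi,\omega\}\le\phi_0+\varepsilon$'' belongs to $\mathcal{A}_0$. An approach structure $\mathcal{A}$ on $X$ assigns to each $x\in X$ a functional ideal $\mathcal{A}_x$ on $X$ such that for each $x\in X$ and $\phi\in\mathcal{A}_x$: (A1) $\phi(x)=0$; (A2) for all $\varepsilon>0$, $\omega<\infty$ there exists $(\phi_x)_x\in\prod_{x\in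 X}\mathcal{A}_x$ such that for all $y,z\in X$: $\min\{\phi(y),\omega\}\le\phi_x(z)+\phi_z(y)+\varepsilon$. A basis for $\mathcal{A}$ is an assignment of $\mathcal{B}_x\subset\mathcal{A}_x$ to each $x\in X$ such that for all $\phi\in\mathcal{A}_x$, $\varepsilon>0$, $\omega<\infty$ there is $\psi\in\mathcal{B}_x$ with $\min\{\phi,\omega\}\le\psi+\varepsilon$. For a metric $m$ on $X$, the approach structure underlying $m$, denoted $\mathcal{A}_m$, is the unique approach structure with basis $\mathcal{B}_{m,x}=\{m(x,\cdot)\}$; explicitly $\mathcal{A}_{m,x}=\{\phi : \phi\le m(x,\cdot)\}$. An approach structure $\mathcal{A}$ is metrized by $m$ iff $\mathcal{A}=\mathcal{A}_m$. Limit operator: for a net $(x_\eta)_\eta$ in $(X,\mathcal{A})$, $x\in X$ and $\alpha>0$, the net is $\alpha$-convergent to $x$ iff for every $\phi\in\mathcal{A}_x$ one has eventually $\phi(x_\eta)<\alpha$; and $\lambda(x_\eta\to x)=\inf\{\alpha>0 : (x_\eta)_\eta \text{ is } \alpha\text{-convergent to } x\}\in[0,\infty]$. A map $f:(X,\mathcal{A})\to(Y,\mathcal{A}')$ between approach spaces is contractive iff $\phi\circ f\in\mathcal{A}_x$ for all $x\in X$ and $\phi\in\mathcal{A}'_{f(x)}$. An approach structure $\mathcal{A}'$ on $X$ is weaker than $\mathcal{A}$ iff $\mathcal{A}'_x\subset\mathcal{A}_x$ for all $x$. For maps $(f_i:Y\to(Y_i,\mathcal{A}_i))_{i\in I}$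 into approach spaces, the weak approach structure for these maps is the weakest approach structure on $Y$ making every $f_i$ contractive; it exists and has as basis $\mathcal{B}_y=\{\max_{k\in K}\phi_k\circ f_k : K\subset I \text{ finite},\ \phi_k\in\mathcal{A}_{k,f_k(y)}\}$. Probability. $\kappa(S,\mathbb{R})$ is the set of contractions, i.e. maps $f:S\to\mathbb{R}$ with $|f(x)-f(y)|\le d(x,y)$ for all $x,y\in S$. $\mathcal{P}^1(S)$ is the set of Borel probability measures $P$ on $S$ with $\int_S d(a,\cdot)\,dP<\infty$ for some (equivalently all) $a\in S$. The Wasserstein metric on $\mathcal{P}^1(S)$ is $W(P,Q)=\inf_\pi\int_{S\times S}d(x,y)\,d\pi(x,y)$, the infimum over all Borel probability measures $\pi$ on $S\times S$ with first marginal $P$ and second marginal $Q$; by Kantorovich duality, $W(P,Q)=\sup_{f\in\kappa(S,\mathbb{R})}\left|\int f\,dP-\int f\,dQ\right|$. $\mathcal{A}_W$ is the approach structure on $\mathcal{P}^1(S)$ underlying $W$, with limit operator $\lambda_W$. The contractive approach structure $\mathcal{A}_\kappa$ on $\mathcal{P}^1(S)$ is the weak approach structure for the collection of maps $\left(\mathcal{P}^1(S)\to\mathbb{R}:P\mapsto\int f\,dP\right)_{f\in\kappa(S,\mathbb{R})}$, where $\mathbb{R}$ carries the approach structure underlying the Euclidean metric; its limit operator is $\lambda_\kappa$. Suprema and superior limits take values in $[0,\infty]$. *)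

(* Defs.v *)
From HB Require Import structures.
From mathcomp Require Import all_boot all_order all_algebra.
From mathcomp Require Import all_classical all_reals all_analysis.

Set Implicit Arguments.
Unset Strict Implicit.
Unset Printing Implicit Defensive.

Import Order.TTheory GRing.Theory Num.Theory.
Import numFieldNormedType.Exports.

Local Open Scope classical_set_scope.
Local Open Scope ring_scope.
Local Open Scope ereal_scope.

Section approach.
Context {R : realType}.

Definition upwards_directed (X : Type) (A0 : set (X -> \bar R)) : Prop :=
  forall phi1 phi2, A0 phi1 -> A0 phi2 ->
    exists2 phi, A0 phi & forall x, maxe (phi1 x) (phi2 x) <= phi x.

Definition dominated (X : Type) (A0 : set (X -> \bar R)) (phi : X -> \bar R) :
    Prop :=
  forall eps omega : R, (0 < eps)%R ->
    exists2 phi0, A0 phi0 &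
      forall x, mine (phi x) omega%:E <= phi0 x + eps%:E.

(* The first conjunct encodes that the members of [A0] take values in
   [[0, +oo]]. *)
Definition functional_ideal (X : Type) (A0 : set (X -> \bar R)) : Prop :=
  [/\ forall phi, A0 phi -> forall x, 0 <= phi x,
      upwards_directed A0 &
      forall phi, (forall x, 0 <= phi x) -> dominated A0 phi -> A0 phi].

Definition approach_structure (X : Type) (A : X -> set (X -> \bar R)) : Prop :=
  [/\ forall x, functional_ideal (A x),
      forall x phi, A x phi -> phi x = 0 &
      forall x phi, A x phi -> forall eps omega : R, (0 < eps)%R ->
        exists2 phi_ : X -> X -> \bar R, (forall w, A w (phi_ w)) &
          forall y z, mine (phi y) omega%:E <= phi_ x z + phi_ z y + eps%:E].

(* Explicit form of the unique approach structure with basis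
   [x |-> [set m x]], for [m] a metric. *)
Definition metric_structure (X : Type) (m : X -> X -> \bar R) (x : X) :
    set (X -> \bar R) :=
  [set phi | forall y, 0 <= phi y <= m x y].

Definition contractive (X Y : Type) (A : X -> set (X -> \bar R))
    (B : Y -> set (Y -> \bar R)) (f : X -> Y) : Prop :=
  forall x phi, B (f x) phi -> A x (phi \o f).

Definition weaker (X : Type) (A' A : X -> set (X -> \bar R)) : Prop :=
  forall x, A' x `<=` A x.

(* The family [f] is restricted to the indices in [D]. By [weak_structureP]
   below, this intersection is the weakest approach structure for which the
   maps [f i] are contractive. *)
Definition weak_structure (I Y : Type) (D : set I) (Z : I -> Type)
    (A : forall i, Z i -> set (Z i -> \bar R)) (f : forall i, Y -> Z i)
    (y : Y) : set (Y -> \bar R) :=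
  [set phi | forall A' : Y -> set (Y -> \bar R), approach_structure A' ->
     (forall i, D i -> contractive A' (A i) (f i)) -> A' y phi].

Record directed (I : Type) (le : I -> I -> Prop) : Prop := Directed {
  directed_inhabited : inhabited I ;
  directed_refl : forall i, le i i ;
  directed_trans : forall i j k, le i j -> le j k -> le i k ;
  directed_ub : forall i j, exists k, le i k /\ le j k }.

Definition eventually_net (I : Type) (le : I -> I -> Prop) (E : I -> Prop) :
    Prop :=
  exists i, forall j, le i j -> E j.

Definition limsup_net (I : Type) (le : I -> I -> Prop) (u : I -> \bar R) :
    \bar R :=
  ereal_inf [set ereal_sup [set u j | j in [set j | le i j]] | i in [set: I]].

Definition alpha_convergent (X : Type) (A : X -> set (X -> \bar R)) (I : Type)
    (le : I -> I -> Prop) (x_ : I -> X) (x : X) (alpha : R) : Prop :=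
  forall phi, A x phi -> eventually_net le (fun i => phi (x_ i) < alpha%:E).

Definition limit_operator (X : Type) (A : X -> set (X -> \bar R)) (I : Type)
    (le : I -> I -> Prop) (x_ : I -> X) (x : X) : \bar R :=
  ereal_inf [set alpha%:E | alpha in
    [set alpha : R | (0 < alpha)%R /\ alpha_convergent A le x_ x alpha]].

End approach.

Section approach_theory.
Context {R : realType}.

Lemma metric_structure_approach (X : Type) (m : X -> X -> \bar R) :
  (forall x y, 0 <= m x y) -> (forall x, m x x = 0) ->
  (forall x y z, m x z <= m x y + m y z) ->
  approach_structure (metric_structure m).
Proof.
move=> m0 mxx mtri; split=> [x|x phi /(_ x)|x phi phim eps omega eps0].
- split=> [phi phim y|phi1 phi2 p1 p2|phi phi0 pd y].
  + by have /andP[] := phim y.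
  + exists (m x) => y; first by rewrite m0 lexx.
    by rewrite ge_max; move: (p1 y) (p2 y) => /andP[_ ->] /andP[_ ->].
  + rewrite phi0/=; have [->|mfin] := eqVneq (m x y) +oo; first exact: leey.
    have mxy : m x y \is a fin_num by rewrite ge0_fin_numE ?m0// ltey.
    apply/lee_addgt0Pr => e e0.
    have [psi psim /(_ y)] := pd e (fine (m x y) + e + 1)%R e0.
    have /andP[_ psiy] := psim y; move=> h.
    have {}h : mine (phi y) (fine (m x y) + e + 1)%:E <= m x y + e%:E.
      by rewrite (le_trans h)// leeD2r.
    move: h; rewrite ge_min => /orP[//|].
    by rewrite -[m x y in leRHS]fineK// -EFinD lee_fin gerDl ler10.
- by rewrite mxx -eq_le => /eqP.
- exists m => [w y|y z]; first by rewrite m0 lexx.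
  rewrite ge_min; apply/orP; left.
  have /andP[_ /le_trans->//] := phim y.
  by rewrite (le_trans (mtri x z y))// leeDl// lee_fin ltW.
Qed.

Lemma weak_structureP (I Y : Type) (D : set I) (Z : I -> Type)
    (A : forall i, Z i -> set (Z i -> \bar R)) (f : forall i, Y -> Z i) :
  (forall i, D i -> approach_structure (A i)) ->
  (forall y, exists2 i, D i & A i (f i y) !=set0) ->
  [/\ approach_structure (weak_structure D A f),
      forall i, D i -> contractive (weak_structure D A f) (A i) (f i) &
      forall A', approach_structure A' ->
        (forall i, D i -> contractive A' (A i) (f i)) ->
        weaker (weak_structure D A f) A'].
Proof.
move=> AD A_neq0.
pose fix_max (psi phi : Y -> \bar R) y := maxe (psi y) (phi y).
pose closed (B : Y -> set (Y -> \bar R)) := forall y,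
  (forall i phi, D i -> A i (f i y) phi -> B y (phi \o f i)) /\
  (forall p q, B y p -> B y q -> B y (fix_max p q)).
pose B y : set (Y -> \bar R) := [set psi | forall B', closed B' -> B' y psi].
have Bgen i y phi : D i -> A i (f i y) phi -> B y (phi \o f i).
  by move=> Di Aphi B' /(_ y)[+ _]; exact.
have Bmax y p q : B y p -> B y q -> B y (fix_max p q).
  by move=> Bp Bq B' B'c; have [_] := B'c y; apply; [exact: Bp|exact: Bq].
have B_ge0 y psi : B y psi -> forall z, 0 <= psi z.
  move=> /(_ (fun=> [set p | forall z, 0 <= p z])); apply=> {psi}y.
  split=> [i phi Di Aphi z|p q p0 q0 z] /=.
    by have [/(_ (f i y))[+ _ _] _ _] := AD i Di; apply.
  by rewrite le_max p0.
have B_xx y psi : B y psi -> psi y = 0.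
  move=> /(_ (fun y => [set psi | psi y = 0])); apply=> {psi}z.
  split=> [i phi Di Aphi|p q] /=.
    by have [_ /(_ _ _ Aphi)] := AD i Di.
  by rewrite /fix_max => -> ->; rewrite maxxx.
have B_neq0 y : B y !=set0.
  by have [i Di [phi Aphi]] := A_neq0 y; exists (phi \o f i); exact: Bgen.
pose W y : set (Y -> \bar R) :=
  [set phi | (forall z, 0 <= phi z) /\ dominated (B y) phi].
have BW y : B y `<=` W y.
  move=> psi Bpsi; split; first exact: (B_ge0 y).
  move=> e o e0; exists psi => // x.
  by rewrite ge_min leeDl// lee_fin ltW.
have ge_fix_max (p q : Y -> \bar R) x :
      p x <= fix_max p q x /\ q x <= fix_max p q x.
  by split; rewrite /fix_max le_max lexx ?orbT.
have B_A2 y psi : B y psi -> forall e o : R, (0 < e)%R ->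
    exists2 phi_ : Y -> Y -> \bar R, (forall w, B w (phi_ w)) &
      forall u z, mine (psi u) o%:E <= phi_ y z + phi_ z u + e%:E.
  move=> /(_ (fun y => [set psi | forall e o : R, (0 < e)%R ->
    exists2 phi_ : Y -> Y -> \bar R, (forall w, B w (phi_ w)) &
      forall u z, mine (psi u) o%:E <= phi_ y z + phi_ z u + e%:E])).
  apply=> {psi y}z; split=> [i phi Di Aphi e o e0|p q Bp Bq e o e0].
    have [_ _ /(_ _ _ Aphi e o e0)[phi_ Aphi_ H]] := AD i Di.
    exists (fun w => phi_ (f i w) \o f i) => [w|u v]; last exact: H.
    exact: Bgen.
  have [p_ Bp_ Hp] := Bp e o e0; have [q_ Bq_ Hq] := Bq e o e0.
  exists (fun w => fix_max (p_ w) (q_ w)) => [w|u v]; first exact: Bmax.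
  have [+ +] := (ge_fix_max (p_ z) (q_ z) v, ge_fix_max (p_ v) (q_ v) u).
  move=> [p1 q1] [p2 q2].
  have Hp' : mine (p u) o%:E <=
      fix_max (p_ z) (q_ z) v + fix_max (p_ v) (q_ v) u + e%:E.
    by rewrite (le_trans (Hp u v))// leeD2r// leeD.
  have Hq' : mine (q u) o%:E <=
      fix_max (p_ z) (q_ z) v + fix_max (p_ v) (q_ v) u + e%:E.
    by rewrite (le_trans (Hq u v))// leeD2r// leeD.
  by rewrite {1}/fix_max maxEle; case: ifPn.
have WA : approach_structure W.
  split=> [y|y phi [phi0 phid]|y phi [phi0 phid] e o e0].
  - split=> [phi []//|p q [p0 pd] [q0 qd]|phi phi0 phid].
    + exists (fix_max p q) => //; split=> [z|e o e0].
        by rewrite /fix_max le_max p0.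
      have [p' Bp' Hp] := pd e o e0; have [q' Bq' Hq] := qd e o e0.
      exists (fix_max p' q') => [|x]; first exact: Bmax.
      have [p1 q1] := ge_fix_max p' q' x.
      have Hp' : mine (p x) o%:E <= fix_max p' q' x + e%:E.
        by rewrite (le_trans (Hp x))// leeD2r.
      have Hq' : mine (q x) o%:E <= fix_max p' q' x + e%:E.
        by rewrite (le_trans (Hq x))// leeD2r.
      by rewrite {1}/fix_max maxEle; case: ifPn.
    + split=> // e o e0.
      have e20 : (0 < e / 2)%R by rewrite divr_gt0.
      have [p [_ pd] Hp] := phid _ o e20.
      have [q Bq Hq] := pd _ o e20; exists q => // x.
      have H1 : mine (phi x) o%:E <= mine (p x) o%:E + (e / 2)%:E.
        rewrite {2}/mine; case: ifPn => _; first exact: Hp.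
        by rewrite ge_min leeDl ?orbT// lee_fin ltW.
      rewrite (le_trans H1)// [in leRHS](splitr e) EFinD addeA.
      by rewrite leeD2r.
  - apply/eqP; rewrite eq_le phi0 andbT; apply/lee_addgt0Pr => e e0.
    have [p Bp /(_ y)] := phid e (e + 1)%R e0.
    by rewrite (B_xx _ _ Bp) ge_min => /orP[//|]; rewrite add0e lee_fin gerDl ler10.
  - have e20 : (0 < e / 2)%R by rewrite divr_gt0.
    have [p Bp Hp] := phid _ o e20.
    have [p_ Bp_ H] := B_A2 y p Bp _ o e20.
    exists p_ => [w|u z]; first exact: BW.
    have H1 : mine (phi u) o%:E <= mine (p u) o%:E + (e / 2)%:E.
      rewrite {2}/mine; case: ifPn => _; first exact: Hp.
      by rewrite ge_min leeDl ?orbT// lee_fin ltW.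
    by rewrite (le_trans H1)// [in leRHS](splitr e) EFinD addeA leeD2r.
have WC i : D i -> contractive W (A i) (f i).
  by move=> Di y phi Aphi; apply: BW; exact: Bgen.
have WE : weak_structure D A f = W.
  apply/funext => y; apply/seteqP; split=> [phi|phi [phi0 phid] A' A'A A'C].
    by apply.
  have [A'id _ _] := A'A.
  have BA' z : B z `<=` A' z.
    move=> psi Bpsi.
    have /Bpsi[//] : closed (fun z => [set q | (forall w, 0 <= q w) /\ A' z q]).
    move=> {Bpsi psi}v; split=> [i q Di Aq|p q [p0 A'p] [q0 A'q]].
      by split; [apply: (B_ge0 v); exact: Bgen|exact: A'C].
    split=> [w|]; first by rewrite /fix_max le_max p0.
    have [_ /(_ _ _ A'p A'q)[s A's pqs] A'cl] := A'id v.
    apply: A'cl => [w|e o e0]; first by rewrite /fix_max le_max p0.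
    exists s => // w; rewrite ge_min; apply/orP; left.
    by rewrite (le_trans (pqs w))// leeDl// lee_fin ltW.
  have [_ _ A'cl] := A'id y.
  apply: A'cl => // e o e0; have [p Bp Hp] := phid e o e0.
  by exists p => //; exact: BA'.
rewrite WE; split=> // A' A'A A'C y phi Wphi.
by rewrite -WE in Wphi; exact: Wphi.
Qed.

End approach_theory.

(* Pointedness, which measurable types require, is part of
   [CompletePseudoMetric]. *)
#[short(type="completeMetricType")]
HB.structure Definition CompleteMetric (R : numDomainType) :=
  { S of Metric R S & CompletePseudoMetric R S }.

Definition separable (T : topologicalType) : Prop :=
  exists2 D : set T, countable D & dense D.

Notation borel T := (g_sigma_algebraType (@open T)).

Section wasserstein.
Context {R : realType}.

Definition euclidean (x y : R) : \bar R := `|x - y|%:E.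

Section defs.
Variable S : completeMetricType R.

Definition kappa : set (S -> R) :=
  [set f | forall x y, (`|f x - f y| <= mdist x y)%R].

Record P1 := MkP1 {
  P1_probability :> probability (borel S) R ;
  P1_moment : exists a : S, \int[P1_probability]_x (mdist a x)%:E < +oo }.

Definition mean (f : S -> R) (P : P1) : R :=
  (\int[P]_(x in [set: borel S]) f x)%R.

(* Couplings live on the Borel sigma-algebra of the product topology. *)
Definition coupling (P Q : P1) : set (probability (borel (S * S)%type) R) :=
  [set pi | (forall A : set (borel S), measurable A ->
               pi (fst @^-1` A) = P A) /\
            (forall A : set (borel S), measurable A ->
               pi (snd @^-1` A) = Q A)].

Definition wasserstein (P Q : P1) : \bar R :=
  ereal_inf [set \int[pi]_z (mdist z.1 z.2)%:E | pi in coupling P Q].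

Definition wasserstein_structure : P1 -> set (P1 -> \bar R) :=
  metric_structure wasserstein.

Definition contractive_structure : P1 -> set (P1 -> \bar R) :=
  weak_structure kappa (fun _ : S -> R => metric_structure euclidean) mean.

End defs.

Arguments kappa : clear implicits.
Arguments wasserstein_structure : clear implicits.
Arguments contractive_structure : clear implicits.

Lemma contractive_structureP (S : completeMetricType R) :
  [/\ approach_structure (contractive_structure S),
      forall f, kappa S f -> contractive (contractive_structure S)
        (metric_structure euclidean) (mean f) &
      forall A', approach_structure A' ->
        (forall f, kappa S f ->
           contractive A' (metric_structure euclidean) (mean f)) ->
        weaker (contractive_structure S) A'].
Proof.
apply: weak_structureP => [f _|P].
  apply: metric_structure_approach => [x y|x|x y z]; rewrite /euclidean.
  - by rewrite lee_fin.
  - by rewrite subrr normr0.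
  - by rewrite -EFinD lee_fin ler_distD.
exists (fun=> 0%R) => [x y|]; first by rewrite subrr normr0 mdist_ge0.
by exists (fun=> 0) => x /=; rewrite lexx /euclidean lee_fin normr_ge0.
Qed.

End wasserstein.

Arguments kappa {R} S _.
Arguments wasserstein_structure {R} S _.
Arguments contractive_structure {R} S _.

(* Main.v *)
Require Import Defs.
From HB Require Import structures.
From mathcomp Require Import all_boot all_order all_algebra.
From mathcomp Require Import all_classical all_reals all_analysis.
From mathcomp Require Import measurable_realfun.
From mathcomp Require Import ring lra.

Set Implicit Arguments.
Unset Strict Implicit.
Unset Printing Implicit Defensive.

Import Order.TTheory GRing.Theory Num.Theory.
Import numFieldNormedType.Exports.

Local Open Scope classical_set_scope.
Local Open Scope ereal_scope.

(** The point is that the supremum over all contractions which defines the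
    Kantorovich distance from a fixed [P] is, up to [e], a maximum over finitely
    many contractions chosen independently of the other measure [Q]
    ([finite_testing]). Let [a 0, ..., a n] be the first points of a dense
    sequence, [n] being so large that the mean under [P] of the distance to
    these points is small ([mean_dist_to_cvg0]). For a contraction [g], let [m]
    be the McShane extension of its restriction to these points, the greatest
    contraction with these values. Then [g <= m <= g + 2 * dist_to a], whence
    the mean of [g] under [Q] minus its mean under [P] is at most the same
    difference for [m], plus twice the mean distance under [P]. Only the values
    of [g] at the [a i] enter in [m]; up to an additive constant and a small
    rounding error there are finitely many of them.

    This gives the interchange of supremum and superior limit at once
    ([limsup_ereal_sup_kappa]). It also shows that the Kantorovich distance from
    [P] belongs to the contractive structure at [P]. To conclude that this
    structure is the one of the Wasserstein metric, given as an infimum over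
    couplings, one needs the Kantorovich-Rubinstein duality
    ([kantorovich_rubinstein]), which also provides the triangle inequality.

    The duality is proved by discretization. Let [p] and [q] be the masses under
    [P] and [Q] of the Voronoi cells of [a 0, ..., a n]. For these finite
    vectors, consider the sublinear functional that maps a matrix [h] to the
    least cost of a separable majorant [phi i + psi j] of [h]. Its linear
    minorants are the couplings of [p] and [q], and a minorant touching it at
    the opposite of the cost matrix, which exists by the Hahn-Banach theorem, is
    an optimal coupling ([finite_kantorovich_duality]). A coupling of the cells
    is turned into a coupling of [P] and [Q] by drawing independently inside the
    cells ([coupling_of_cells]); the cost increases by at most the mean
    distances to the points, which tend to 0. *)

(** * Sublinear functionals and finite transport duality *)

Section sublinear.
Local Open Scope ring_scope.
Context {R : realType} {V : lmodType R}.
Implicit Types (p q : V -> R) (v x y : V).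

Definition sublinear p : Prop :=
  (forall x y, p (x + y) <= p x + p y) /\
  (forall (t : R) x, 0 < t -> p (t *: x) <= t * p x).

Lemma sublinear0 p : sublinear p -> p 0 = 0.
Proof.
move=> [pD pZ]; have := pD 0 0; rewrite addr0 => p00.
have h2 : (0 < 2^-1 :> R) by rewrite invr_gt0.
by have := pZ 2^-1 0 h2; rewrite scaler0 => p0h; lra.
Qed.

Lemma sublinearZ p (t : R) x : sublinear p -> 0 <= t ->
  p (t *: x) = t * p x.
Proof.
move=> p_sub; have [pD pZ] := p_sub.
rewrite le_eqVlt => /predU1P[<-|t0].
  by rewrite scale0r mul0r sublinear0.
apply/eqP; rewrite eq_le pZ//=.
have := pZ t^-1 (t *: x); rewrite invr_gt0 => /(_ t0).
by rewrite scalerA mulVf ?gt_eqF// scale1r mulrC ler_pdivlMr// mulrC.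
Qed.

Lemma sublinearN_ge p x : sublinear p -> (- p (- x) <= p x).
Proof.
move=> p_sub; have [pD _] := p_sub.
by have := pD x (- x); rewrite subrr sublinear0// => ?; lra.
Qed.

Lemma inf_sublinear (E : V -> set R) :
  (forall x, E x !=set0) -> (forall x, has_lbound (E x)) ->
  (forall x y a b, E x a -> E y b -> E (x + y) (a + b)) ->
  (forall (t : R) x a, 0 < t -> E x a -> E (t *: x) (t * a)) ->
  sublinear (fun x => inf (E x)).
Proof.
move=> E0 Eb ED EZ; split=> [x y|t x t0].
  apply/ler_addgt0Pr => e e0; have e20 : (0 < e / 2) by rewrite divr_gt0.
  have [a Ea ae] := inf_adherent e20 (conj (E0 x) (Eb x)).
  have [b Eb' be] := inf_adherent e20 (conj (E0 y) (Eb y)).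
  have := ge_inf (Eb (x + y)) (ED _ _ _ _ Ea Eb'); lra.
rewrite mulrC -ler_pdivrMr//; apply: lb_le_inf => [//|a Ea].
by rewrite ler_pdivrMr// mulrC; apply: ge_inf => //; exact: EZ.
Qed.

(** The one-step reduction in the proof of the Hahn-Banach theorem. Taking the
    infimum of [p (x + t *: v) - t * p v] over [t >= 0] yields a smaller
    sublinear functional; the choice [t = 1] at [x = - v] makes it linear on
    the line through [v] and keeps the value [p v] there. *)
Lemma sublinear_line p v : sublinear p ->
  exists q, [/\ sublinear q, forall x, q x <= p x &
    q (- v) <= - p v].
Proof.
move=> p_sub; have [pD pZ] := p_sub.
(* Up-closed value sets make the closure conditions of the infimum
   inequalities. *)
pose E x := [set a | exists2 t : R, (0 <= t) & (p (x + t *: v) - t * p v <= a)].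
have E0 x : E x (p x) by exists 0 => //; rewrite scale0r addr0 mul0r subr0.
have E_lb x : has_lbound (E x).
  exists (- p (- x)) => a [t t0 le_a].
  have := pD (x + t *: v) (- x).
  by rewrite addrAC subrr add0r sublinearZ// => ?; lra.
exists (fun x => inf (E x)); split.
- apply: inf_sublinear => //.
  + by move=> x; exists (p x).
  + move=> x y a b [s s0 le_a] [t t0 le_b]; exists (s + t).
      by rewrite addr_ge0.
    have := pD (x + s *: v) (y + t *: v).
    by rewrite addrACA -scalerDl mulrDl => ?; lra.
  + move=> t x a t0 [s s0 le_a]; exists (t * s); first by rewrite mulr_ge0// ltW.
    have := pZ t (x + s *: v) t0.
    rewrite scalerDr scalerA => h.
    have : (t * (p (x + s *: v) - s * p v) <= t * a) by rewrite ler_wpM2l// ltW.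
    by rewrite mulrBr mulrA => ?; lra.
- by move=> x; apply: (ge_inf (E_lb x)); exact: E0.
- apply: (ge_inf (E_lb _)); exists 1 => //.
  by rewrite scale1r addNr sublinear0// mul1r sub0r.
Qed.

(** Linearity along a line is inherited by all smaller sublinear functionals,
    so the lines can be treated one after the other. *)
Lemma sublinear_lines p (s : seq V) : sublinear p ->
  exists q, [/\ sublinear q, forall x, q x <= p x &
    forall v, v \in s -> q (- v) = - q v].
Proof.
elim: s p => [|v s IHs] p p_sub; first by exists p.
have [q [q_sub qp qv]] := sublinear_line v p_sub.
have [r [r_sub rq rs]] := IHs q q_sub; exists r; split=> //.
  by move=> x; exact: le_trans (qp x).
move=> u; rewrite inE => /predU1P[->|/rs//].
have := sublinearN_ge v r_sub.
have := rq (- v); have := rq v; have := qp v.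
by move=> ? ? ? ?; apply/eqP; rewrite eq_le; apply/andP; split; lra.
Qed.

End sublinear.

Section finite_transport.
Local Open Scope ring_scope.

(** The Hahn-Banach theorem on a space of matrices. The first reduction is along
    [v], to make the linear minorant touch [p] there; the next ones are along
    the matrix units, which span the space. *)
Lemma sublinear_dominates_linear (R : realType) (m n : nat)
    (p : 'M[R]_(m, n) -> R) (v : 'M[R]_(m, n)) : sublinear p ->
  exists w : 'M[R]_(m, n),
    (forall h : 'M[R]_(m, n), (\sum_i \sum_j h i j * w i j <= p h)) /\
    (p v <= \sum_i \sum_j v i j * w i j).
Proof.
move=> p_sub.
have [q [q_sub qp qv]] := sublinear_line v p_sub.
have [r [r_sub rq rs]] :=
  sublinear_lines [seq delta_mx ij.1 ij.2 | ij : 'I_m * 'I_n] q_sub.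
pose w : 'M[R]_(m, n) := \matrix_(i, j) r (delta_mx i j).
have rN i j : r (- delta_mx i j) = (- w i j).
  by rewrite rs ?mxE//; apply/mapP; exists (i, j) => //; rewrite mem_enum.
have rZ (t : R) i j : r (t *: delta_mx i j) = (t * w i j).
  case: (leP 0 t) => [t0|/ltW t0]; first by rewrite sublinearZ// mxE.
  rewrite -[t in LHS]opprK scaleNr -scalerN sublinearZ ?oppr_ge0//.
  by rewrite rN mulrNN.
have [rD _] := r_sub.
have r_sum (I : Type) (s : seq I) (F : I -> 'M[R]_(m, n)) :
    (r (\sum_(i <- s) F i) <= \sum_(i <- s) r (F i)).
  elim: s => [|i s IHs]; first by rewrite !big_nil sublinear0.
  by rewrite !big_cons (le_trans (rD _ _))// lerD2l.
have rw (h : 'M[R]_(m, n)) : (r h <= \sum_i \sum_j h i j * w i j).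
  rewrite {1}(matrix_sum_delta h) (le_trans (r_sum _ _ _))//.
  apply: ler_sum => i _; rewrite (le_trans (r_sum _ _ _))//.
  by apply: ler_sum => j _; rewrite rZ.
have rNw (h : 'M[R]_(m, n)) : (r (- h) <= - \sum_i \sum_j h i j * w i j).
  rewrite (le_trans (rw _))// -sumrN ler_sum// => i _.
  by rewrite -sumrN ler_sum// => j _; rewrite mxE mulNr.
exists w; split=> [h|].
  have := sublinearN_ge h r_sub; have := rNw h; have := rq h; have := qp h.
  by move=> *; lra.
have := sublinearN_ge v r_sub; have := rq (- v); have := rw v.
by move=> *; lra.
Qed.

Context {R : realType} {m n : nat}.
Variables (p : 'I_m -> R) (q : 'I_n -> R).
Hypotheses (p0 : forall i, 0 <= p i) (q0 : forall j, 0 <= q j).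
Hypotheses (p1 : \sum_i p i = 1) (q1 : \sum_j q j = 1).

(** The price of the cheapest separable majorant of [h] is the sublinear
    functional whose linear minorants are exactly the couplings of [p] and
    [q]. *)
Definition majorant_values (h : 'M[R]_(m, n)) : set R :=
  [set a | exists phi : 'I_m -> R, exists psi : 'I_n -> R,
    (forall i j, h i j <= phi i + psi j) /\
    a = (\sum_i phi i * p i + \sum_j psi j * q j)].

Lemma majorant_values_neq0 h : majorant_values h !=set0.
Proof.
pose M := (\sum_i \sum_j `|h i j|).
exists (\sum_i M * p i + \sum_j 0 * q j), (fun=> M), (fun=> 0).
split=> // i j; rewrite addr0 (le_trans (ler_norm _))//.
rewrite /M (bigD1 i)//= (bigD1 j)//= -addrA lerDl addr_ge0 ?sumr_ge0//.
by move=> k _; rewrite sumr_ge0.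
Qed.

Lemma majorant_values_lbound h : has_lbound (majorant_values h).
Proof.
exists (\sum_i \sum_j h i j * (p i * q j)) => _ [phi [psi [hphi ->]]].
have -> : (\sum_i phi i * p i + \sum_j psi j * q j =
    \sum_i \sum_j (phi i + psi j) * (p i * q j)).
  under [RHS]eq_bigr do under eq_bigr do rewrite mulrDl.
  under [RHS]eq_bigr do rewrite big_split/=.
  rewrite big_split/=; congr (_ + _).
    apply: eq_bigr => i _; rewrite -mulr_sumr -mulr_sumr q1.
    by rewrite mulr1.
  rewrite exchange_big/=; apply: eq_bigr => j _.
  under eq_bigr do rewrite mulrCA.
  by rewrite -mulr_suml p1 mul1r.
apply: ler_sum => i _; apply: ler_sum => j _.
by rewrite ler_wpM2r// mulr_ge0.
Qed.

Lemma majorant_price_sublinear :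
  sublinear (fun h => inf (majorant_values h)).
Proof.
apply: inf_sublinear.
- exact: majorant_values_neq0.
- exact: majorant_values_lbound.
- move=> h k _ _ [phi [psi [hphi ->]]] [phi' [psi' [kphi ->]]].
  exists (fun i => phi i + phi' i), (fun j => psi j + psi' j); split.
    by move=> i j; rewrite mxE addrACA lerD.
  rewrite addrACA -!big_split; congr (_ + _); apply: eq_bigr => i _;
  by rewrite mulrDl.
- move=> t h _ t0 [phi [psi [hphi ->]]].
  exists (fun i => t * phi i), (fun j => t * psi j); split.
    by move=> i j; rewrite mxE -mulrDr ler_pM2l.
  by rewrite mulrDr !mulr_sumr; congr (_ + _); apply: eq_bigr => i _;
    rewrite mulrA.
Qed.

Lemma majorant_price_le (h : 'M[R]_(m, n)) phi psi :
  (forall i j, h i j <= phi i + psi j) ->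
  (inf (majorant_values h) <= \sum_i phi i * p i + \sum_j psi j * q j).
Proof.
by move=> hphi; apply: (ge_inf (majorant_values_lbound h)); exists phi, psi.
Qed.

(** A linear functional [w] below the majorant price is nonnegative, since the
    price of a nonpositive matrix is at most 0, and has the marginals [p] and
    [q], since the price of a separable matrix [phi i + psi j] and of its
    opposite is at most what this decomposition costs. If moreover [w] touches
    the price at [- c], then its transport cost is the supremum of the dual
    values. *)
Lemma finite_kantorovich_duality (c : 'M[R]_(m, n)) (e : R) : 0 < e ->
  exists w : 'M[R]_(m, n), exists phi : 'I_m -> R, exists psi : 'I_n -> R,
  [/\ forall i j, (0 <= w i j),
      forall i, (\sum_j w i j = p i),
      forall j, (\sum_i w i j = q j),
      forall i j, (phi i + psi j <= c i j) &
      (\sum_i \sum_j c i j * w i j <=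
       \sum_i phi i * p i + \sum_j psi j * q j + e)].
Proof.
move=> e0.
have [w [w_le w_ge]] := sublinear_dominates_linear (- c) majorant_price_sublinear.
have [_ [phi [psi [cphi ->]]] Hlt] :=
  inf_adherent e0 (conj (majorant_values_neq0 (- c)) (majorant_values_lbound (- c))).
(* An inequality for [h] and for [- h] is an equality: this gives the
   marginals. *)
have wE (h : 'M[R]_(m, n)) (phi' : 'I_m -> R) psi' :
    (forall i j, h i j = phi' i + psi' j) ->
    (\sum_i \sum_j h i j * w i j = \sum_i phi' i * p i + \sum_j psi' j * q j).
  move=> hE; apply/eqP; rewrite eq_le; apply/andP; split.
    by rewrite (le_trans (w_le _))// majorant_price_le// => i j; rewrite hE.
  have hN : forall i j, ((- h) i j <= - phi' i + - psi' j).
    by move=> i j; rewrite mxE hE opprD.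
  have := le_trans (w_le _) (majorant_price_le hN).
  rewrite [X in X <= _](_ : _ = - \sum_i \sum_j h i j * w i j).
    rewrite [X in _ <= X + _](_ : _ = - \sum_i phi' i * p i).
      rewrite [X in _ <= _ + X](_ : _ = - \sum_j psi' j * q j).
        by rewrite -opprD lerN2.
      by rewrite -sumrN; apply: eq_bigr => j _; rewrite mulNr.
    by rewrite -sumrN; apply: eq_bigr => j _; rewrite mulNr.
  rewrite -sumrN; apply: eq_bigr => i _; rewrite -sumrN.
  by apply: eq_bigr => j _; rewrite mxE mulNr.
have single (k : nat) (F : 'I_k -> R) i : \sum_j (j == i)%:R * F j = F i.
  rewrite (bigD1 i)//= eqxx mul1r big1 ?addr0// => j /negbTE ->.
  by rewrite mul0r.
exists w, (fun i => - phi i), (fun j => - psi j); split.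
- move=> i j.
  have := w_le (- delta_mx i j).
  rewrite (bigD1 i)//= (bigD1 j)//= !mxE !eqxx.
  rewrite big1 => [|l /negbTE lj]; last by rewrite !mxE lj andbF oppr0 mul0r.
  rewrite [X in _ + X]big1 => [|k /negbTE ki]; last first.
    by rewrite big1// => l _; rewrite !mxE ki oppr0 mul0r.
  rewrite mulN1r !addr0 => /le_trans.
  have /(@majorant_price_le (- delta_mx i j) (fun=> 0) (fun=> 0)) h0 :
      forall k l, (- delta_mx i j : 'M[R]_(m, n)) k l <= 0 + 0.
    by move=> k l; rewrite !mxE addr0 oppr_le0 ler0n.
  move=> /(_ _ h0); rewrite big1 ?big1 ?addr0 ?oppr_le0// => k _.
    by rewrite mul0r.
  by rewrite mul0r.
- move=> i.
  have := wE (\matrix_(k, l) (k == i)%:R) (fun k => (k == i)%:R) (fun=> 0).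
  rewrite single [X in _ -> _ = _ + X]big1 ?addr0 => [<-|j _]; last first.
  + by rewrite mul0r.
  + by move=> k l; rewrite mxE addr0.
  rewrite -[LHS](single _ (fun k => \sum_j w k j)); apply: eq_bigr => k _.
  by rewrite mulr_sumr; apply: eq_bigr => l _; rewrite mxE.
- move=> j.
  have := wE (\matrix_(k, l) (l == j)%:R) (fun=> 0) (fun l => (l == j)%:R).
  rewrite single [X in _ -> _ = X + _]big1 ?add0r => [<-|i _]; last first.
  + by rewrite mul0r.
  + by move=> k l; rewrite mxE add0r.
  apply: eq_bigr => k _; rewrite -[LHS](single _ (w k)).
  by apply: eq_bigr => l _; rewrite mxE.
- by move=> i j; have := cphi i j; rewrite mxE -opprD lerNl.
- have sN k (F G : 'I_k -> R) : \sum_i - F i * G i = - \sum_i F i * G i.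
    by rewrite -sumrN; apply: eq_bigr => i _; rewrite mulNr.
  rewrite !sN.
  have : \sum_i \sum_j (- c) i j * w i j = - \sum_i \sum_j c i j * w i j.
    rewrite -sumrN; apply: eq_bigr => i _; rewrite -sN.
    by apply: eq_bigr => j _; rewrite mxE.
  by move=> E; move: w_ge; rewrite E => w_ge; lra.
Qed.

End finite_transport.

(** * Contractions and McShane extensions *)

Section lipschitz.
Local Open Scope ring_scope.
Context {R : realType} {S : completeMetricType R}.
Implicit Types (f : S -> R) (x y : S).

Lemma kappa_continuous f : kappa S f -> continuous f.
Proof.
move=> f_kappa x; apply/cvgrPdist_lt => e e0.
apply/nbhs_ballP; exists e => //= y; rewrite ballEmdist/=.
exact: le_lt_trans (f_kappa _ _).
Qed.

Lemma kappaN f : kappa S f -> kappa S (fun x => - f x).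
Proof. by move=> f_kappa x y; rewrite -opprD normrN f_kappa. Qed.

Lemma kappa_mdist a : kappa S (fun x => mdist x a).
Proof.
move=> x y; rewrite ler_norml; have := metric_triangle x y a.
have := metric_triangle y x a; rewrite (metric_sym y x).
by move=> ? ?; apply/andP; split; lra.
Qed.

Lemma kappa_le f a x : kappa S f -> f x <= f a + mdist x a.
Proof. by move=> /(_ x a) /ler_normlW; rewrite lerBlDl. Qed.

Section mcshane.
Variables (n : nat) (a : 'I_n.+1 -> S).
Implicit Types v : 'I_n.+1 -> R.

(** McShane's formula for the greatest 1-Lipschitz function whose value at
    [a i] is at most [v i]. *)
Definition mcshane v x : R :=
  \big[Num.min/v ord0 + mdist x (a ord0)]_i (v i + mdist x (a i)).

Lemma mcshane_le v x i : mcshane v x <= v i + mdist x (a i).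
Proof. exact: bigmin_le. Qed.

Lemma mcshane_ge v x r : (forall i, r <= v i + mdist x (a i)) ->
  r <= mcshane v x.
Proof. by move=> h; apply: le_bigmin. Qed.

Lemma mcshane_attained v x : exists i, mcshane v x = v i + mdist x (a i).
Proof.
have /bigmin_leP[|[i _]] := lexx (mcshane v x); last first.
  by move=> le_i; exists i; apply/eqP; rewrite eq_le le_i mcshane_le.
by move=> le_0; exists ord0; apply/eqP; rewrite eq_le le_0 mcshane_le.
Qed.

Lemma mcshane_kappa v : kappa S (mcshane v).
Proof.
have lip x y : mcshane v x <= mcshane v y + mdist x y.
  have [i ->] := mcshane_attained v y.
  rewrite (le_trans (mcshane_le v x i))// -addrA lerD2l addrC.
  exact: metric_triangle.
move=> x y; rewrite ler_norml; have := lip x y; have := lip y x.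
by rewrite (metric_sym y x) => ? ?; apply/andP; split; lra.
Qed.

Lemma mcshane_perturb v w e x : (forall i, v i <= w i + e) ->
  mcshane v x <= mcshane w x + e.
Proof.
move=> vw; have [i ->] := mcshane_attained w x.
by rewrite (le_trans (mcshane_le v x i))// addrAC lerD2r.
Qed.

Definition dist_to x : R := mcshane (fun=> 0) x.

Lemma dist_to_le x i : dist_to x <= mdist x (a i).
Proof. by have := mcshane_le (fun=> 0) x i; rewrite add0r. Qed.

Lemma dist_to_attained x : exists i, dist_to x = mdist x (a i).
Proof. by have [i] := mcshane_attained (fun=> 0) x; rewrite add0r; exists i. Qed.

Lemma dist_to_ge0 x : 0 <= dist_to x.
Proof. by have [i ->] := dist_to_attained x; exact: mdist_ge0. Qed.

Lemma kappa_le_mcshane f x : kappa S f -> f x <= mcshane (f \o a) x.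
Proof. by move=> f_kappa; apply: mcshane_ge => i; exact: kappa_le. Qed.

(** Together with [kappa_le_mcshane], this says that the extension of the
    restriction of [f] to the points [a i] approximates [f] from above, with an
    error controlled by the distance to these points. *)
Lemma mcshane_le_kappa f x : kappa S f ->
  mcshane (f \o a) x <= f x + 2 * dist_to x.
Proof.
move=> f_kappa; have [i ->] := dist_to_attained x.
rewrite (le_trans (mcshane_le _ _ i))//=.
have := kappa_le (a i) x (kappaN f_kappa).
by have := kappa_le x (a i) f_kappa; rewrite metric_sym; lra.
Qed.

End mcshane.
End lipschitz.

(** * Means of contractions *)

Section borel_measurability.
Context {R : realType}.

Lemma measurable_generated_real (T : pointedType) (G : set (set T))
    (f : T -> R) :
  (forall U : set R, open U -> G (f @^-1` U)) ->
  measurable_fun [set: g_sigma_algebraType G] f.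
Proof.
move=> Gf; apply: (measurability _ (RGenOpens.measurableE R)).
move=> _ [_ [x [y ->] <-]]; rewrite setTI.
by apply: sub_sigma_algebra; apply: Gf; exact: interval_open.
Qed.

End borel_measurability.

Section integration.
Context {R : realType} {S : completeMetricType R}.
Implicit Types (f : S -> R) (P Q : P1 S).

Lemma kappa_measurable f : kappa S f ->
  measurable_fun [set: borel S] (f : borel S -> R).
Proof.
move=> f_kappa.
apply: measurable_generated_real => U oU.
by have /continuousP := kappa_continuous f_kappa; apply.
Qed.

Lemma mdist_integrable P a :
  P.-integrable [set: borel S] (EFin \o (fun x : borel S => mdist x a)).
Proof.
have [b Pb] := P1_moment P.
apply: (@le_integrable _ _ _ _ _ _ _
  (fun x : borel S => (mdist b x)%:E + (mdist b a)%:E)) => //.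
- by apply/measurable_EFinP; exact: (kappa_measurable (kappa_mdist a)).
- move=> x _ /=; rewrite lee_fin ger0_norm ?mdist_ge0// ger0_norm ?addr_ge0 ?mdist_ge0//.
  by rewrite metric_sym addrC (metric_sym b a) (le_trans (metric_triangle _ b _)).
- apply: integrableD => //; last first.
    by apply: finite_measure_integrable_cst.
  apply/integrableP; split.
    apply/measurable_EFinP; apply: (@kappa_measurable (mdist b)).
    by move=> x y; rewrite !(metric_sym b); exact: kappa_mdist.
  by under eq_integral do rewrite abse_EFin ger0_norm ?mdist_ge0//.
Qed.

Lemma kappa_integrable f P : kappa S f ->
  P.-integrable [set: borel S] (EFin \o (f : borel S -> R)).
Proof.
move=> f_kappa; pose a : S := point.
apply: (@le_integrable _ _ _ _ _ _ _
  (fun x : borel S => (mdist x a)%:E + `|f a|%:E)) => //.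
- by apply/measurable_EFinP; exact: kappa_measurable.
- move=> x _ /=; rewrite lee_fin [leRHS]ger0_norm ?addr_ge0 ?mdist_ge0//.
  have := f_kappa x a; have := ler_normD (f x - f a)%R (f a).
  by rewrite subrK => h1 h2; rewrite (le_trans h1)// lerD2r.
- apply: integrableD => //; first exact: mdist_integrable.
  by apply: finite_measure_integrable_cst.
Qed.

Lemma mean_cst P (c : R) : mean (fun=> c) P = c.
Proof.
rewrite /mean Rintegral_cst// [X in fine X](_ : _ = 1) ?mulr1//.
exact: probability_setT.
Qed.

(** Covers both kinds of error terms: a rounding error [c] and a multiple of the
    distance [h] to finitely many points. *)
Lemma mean_le f g h P (k c : R) : kappa S f -> kappa S g -> kappa S h ->
  (forall x, f x <= g x + k * h x + c)%R ->
  (mean f P <= mean g P + k * mean h P + c)%R.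
Proof.
move=> f_kappa g_kappa h_kappa fgh.
have if_ := kappa_integrable P f_kappa.
have ig := kappa_integrable P g_kappa.
have ih := kappa_integrable P h_kappa.
have ikh : P.-integrable [set: borel S] (EFin \o (fun x : borel S => k * h x)%R).
  by apply: (@integrableZl _ _ _ P _ _ k _ ih).
have igh : P.-integrable [set: borel S]
    (EFin \o (fun x : borel S => g x + k * h x)%R).
  exact: (@integrableD _ _ _ P _ _ _ _ ig ikh).
have ic : P.-integrable [set: borel S] (EFin \o (fun x : borel S => c)).
  exact: finite_measure_integrable_cst.
have -> : (mean g P + k * mean h P + c =
    \int[P]_(x in [set: borel S]) (g x + k * h x + c))%R.
  rewrite !RintegralD// RintegralZl//; congr (_ + _)%R.
  exact/esym/mean_cst.
by apply: le_Rintegral => //; exact: (@integrableD _ _ _ P _ _ _ _ igh ic).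
Qed.

Lemma meanN f P : kappa S f -> mean (fun x => - f x)%R P = (- mean f P)%R.
Proof.
move=> f_kappa; rewrite -mulN1r -(RintegralZl _ measurableT (kappa_integrable P f_kappa)).
by apply: eq_Rintegral => x _; rewrite mulN1r.
Qed.

Lemma kappa_sub_cst f (c : R) : kappa S f -> kappa S (fun x => f x - c)%R.
Proof.
move=> f_kappa x y; have -> : (f x - c - (f y - c) = f x - f y)%R by lra.
exact: f_kappa.
Qed.

Lemma mean_sub_cst f P (c : R) : kappa S f ->
  mean (fun x => f x - c)%R P = (mean f P - c)%R.
Proof.
move=> f_kappa; have fc_kappa := kappa_sub_cst c f_kappa.
have := mean_le (k := 0%R) P fc_kappa f_kappa f_kappa (fun x => _ : _ <= _ + _ + - c)%R.
have := mean_le (k := 0%R) P f_kappa fc_kappa f_kappa (fun x => _ : _ <= _ + _ + c)%R.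
rewrite !mul0r !addr0 -lerBlDr => h1 h2.
apply/eqP; rewrite eq_le h2 ?h1// => x; by rewrite mul0r addr0 ?subrK.
Qed.

Lemma mean_EFin f P : kappa S f ->
  (mean f P)%:E = \int[P]_(x in [set: borel S]) (f x)%:E.
Proof.
move=> /(kappa_integrable P) f_int; rewrite fineK//.
exact: integrable_fin_num.
Qed.

Lemma separable_dense_seq : separable S ->
  exists a : nat -> S, forall (x : S) (e : R), (0 < e)%R ->
    exists i, (mdist x (a i) < e)%R.
Proof.
move=> [D cD dD].
have /pfcard_geP[D0|[a]] := cD.
  have [x []] := dD setT (ex_intro _ point I) openT.
  by rewrite D0.
exists a => x e e0.
have [y [xy Dy]] := dD (ball x e)^°
  (ex_intro _ x (nbhsx_ballx x _ e0)) (open_interior _).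
have [i _ ai] := 'surj_a Dy; exists i.
by rewrite ai; have := interior_subset xy; rewrite ballEmdist.
Qed.

(** This replaces tightness: the distance to the first points of a dense
    sequence tends to 0 pointwise and is dominated by the distance to one
    point, which has a finite mean. *)
Lemma mean_dist_to_cvg0 (a : nat -> S) P :
  (forall (x : S) (e : R), (0 < e)%R -> exists i, (mdist x (a i) < e)%R) ->
  mean (dist_to (fun i : 'I_n.+1 => a i)) P @[n --> \oo] --> (0 : R)%R.
Proof.
move=> a_dense.
pose D n := dist_to (fun i : 'I_n.+1 => a i).
have Dk n : kappa S (D n) by exact: mcshane_kappa.
have Dm n : measurable_fun [set: borel S] (EFin \o (D n : borel S -> R)).
  by apply/measurable_EFinP; exact: kappa_measurable.
have D_cvg x : (D n x)%:E @[n --> \oo] --> (0%:E : \bar R).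
  apply: cvg_EFin; first exact: nearW.
  apply/cvgrPdist_lt => e e0; have [i xi] := a_dense x e e0.
  exists i => // n /= ni.
  rewrite sub0r normrN ger0_norm ?dist_to_ge0// (le_lt_trans _ xi)//.
  have ni1 : (i < n.+1)%N by [].
  exact: (dist_to_le (fun i : 'I_n.+1 => a i) x (Ordinal ni1)).
have D_le x n : `|(D n x)%:E| <= (mdist x (a 0%N))%:E.
  rewrite abse_EFin lee_fin ger0_norm ?dist_to_ge0//.
  exact: (dist_to_le (fun i : 'I_n.+1 => a i) x ord0).
have [_ _] := @dominated_convergence _ _ _ P _ measurableT
  (fun n => EFin \o (D n : borel S -> R)) (cst 0)
  (EFin \o (fun x : borel S => mdist x (a 0%N))) Dm
  (measurable_cst _)
  (aeW P (fun x _ => D_cvg x)) (mdist_integrable P (a 0%N))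
  (aeW P (fun x n _ => D_le x n)).
rewrite integral0 => /fine_cvg/=; apply: cvg_trans.
by apply: near_eq_cvg; near=> n.
Unshelve. all: by end_near.
Qed.

End integration.

(** * Gluing two probabilities along a coupling of their cells *)

(** The marginal computation for the glued measure below, with [p] and [q] the
    masses of the cells and [x] the masses of their traces on a fixed set. A
    cell of mass 0 carries no mass of [w], so that the division by 0 is
    harmless. *)
Lemma glued_marginal (R : realFieldType) (m n : nat) (w : 'M[R]_(m, n))
    (p x : 'I_m -> R) (q : 'I_n -> R) :
  (forall i j, 0 <= w i j)%R ->
  (forall i, \sum_j w i j = p i)%R -> (forall j, \sum_i w i j = q j)%R ->
  (forall i, 0 <= x i <= p i)%R ->
  (\sum_i \sum_j w i j / (p i * q j) * (x i * q j) = \sum_i x i)%R.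
Proof.
move=> w0 wp wq xp; apply: eq_bigr => i _.
have [pi0|pi0] := eqVneq (p i) 0%R.
  have -> : x i = 0%R by have := xp i; rewrite pi0 -eq_le => /eqP.
  by rewrite big1// => j _; rewrite mul0r mulr0.
transitivity (\sum_j w i j * (x i / p i))%R; last first.
  by rewrite -mulr_suml wp mulrC divfK.
apply: eq_bigr => j _; have [qj0|qj0] := eqVneq (q j) 0%R; last by field; exact/andP.
have /eqP -> : w i j == 0%R; last by rewrite !mul0r.
rewrite eq_le w0 andbT -[leRHS]qj0 -wq (bigD1 i)//= lerDl sumr_ge0//.
Qed.

Lemma sum_cells (R : realType) d (T : measurableType d) (P : probability T R)
    (n : nat) (A : nat -> set T) (X : set T) :
  (forall i, measurable (A i)) -> trivIset [set: nat] A ->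
  \big[setU/set0]_(i < n.+1) A i = setT -> measurable X ->
  (\sum_(i < n.+1) fine (P (X `&` A i)) = fine (P X))%R.
Proof.
move=> mA tA cA mX; rewrite -[X in RHS]setIT -cA big_distrr/=.
have mXA i : measurable (X `&` A i) by exact: measurableI.
have tXA : trivIset [set: nat] (fun i => X `&` A i) by exact: trivIset_setIl.
rewrite (_ : P _ = \sum_(i < n.+1) P (X `&` A i)); last first.
  exact: (measure_bigsetU P mXA tXA).
under [in RHS]eq_bigr do rewrite -[P _]fineK ?fin_num_measure//.
by rewrite sumEFin.
Qed.

Section glue.
Context {R : realType} {d1 d2 : measure_display}.
Context {T1 : measurableType d1} {T2 : measurableType d2}.
Variables (P : probability T1 R) (Q : probability T2 R) (n : nat).
Variables (A : nat -> set T1) (B : nat -> set T2).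
Hypotheses (mA : forall i, measurable (A i)) (mB : forall i, measurable (B i)).
Hypotheses (tA : trivIset [set: nat] A) (tB : trivIset [set: nat] B).
Hypotheses (cA : \big[setU/set0]_(i < n.+1) A i = setT).
Hypotheses (cB : \big[setU/set0]_(i < n.+1) B i = setT).
Variable w : 'M[R]_n.+1.
Hypothesis w0 : forall i j, (0 <= w i j)%R.
Hypothesis wP : forall i, (\sum_j w i j = fine (P (A i)))%R.
Hypothesis wQ : forall j, (\sum_i w i j = fine (Q (B j)))%R.

Let density (i j : nat) : R :=
  (w (inord i) (inord j) / (fine (P (A i)) * fine (Q (B j))))%R.

Let density_ge0 i j : (0 <= density i j)%R.
Proof. by rewrite divr_ge0 ?mulr_ge0 ?fine_ge0. Qed.

Let mAB i j : measurable (A i `*` B j).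
Proof. exact: measurableX. Qed.

(** Draw a pair of cells according to [w], then draw the two coordinates
    independently inside the chosen cells according to [P] and [Q]. *)
Definition glued_measure : measure (T1 * T2)%type R :=
  msum (fun i => msum (fun j =>
    mscale (NngNum (density_ge0 i j)) (mrestr (P \x Q) (mAB i j))) n.+1) n.+1.

Lemma glued_measureX (X : set T1) (Y : set T2) :
  measurable X -> measurable Y ->
  glued_measure (X `*` Y) = (\sum_(i < n.+1) \sum_(j < n.+1)
    w i j / (fine (P (A i)) * fine (Q (B j))) *
    (fine (P (X `&` A i)) * fine (Q (Y `&` B j))))%:E.
Proof.
move=> mX mY; rewrite /glued_measure /= /msum /= -sumEFin.
apply: eq_bigr => i _; rewrite -sumEFin; apply: eq_bigr => j _.
transitivity ((density i j)%:E *
    (P \x Q) ((X `&` A i) `*` (Y `&` B j))).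
  by rewrite setXI.
rewrite product_measure1E; [|exact: measurableI..].
rewrite /density !inord_val [RHS]EFinM [X in _ = _ * X]EFinM.
by rewrite !fineK// fin_num_measure//; exact: measurableI.
Qed.

Lemma glued_measure_fst X : measurable X -> glued_measure (X `*` setT) = P X.
Proof.
move=> mX; rewrite glued_measureX//.
under eq_bigr do under eq_bigr do rewrite setTI.
rewrite (glued_marginal w0 wP wQ) => [|i].
  by rewrite (sum_cells P mA tA cA mX) fineK// fin_num_measure.
rewrite fine_ge0//= fine_le ?fin_num_measure//; first exact: measurableI.
by rewrite le_measure// inE//; exact: measurableI.
Qed.

Lemma glued_measure_snd Y : measurable Y -> glued_measure (setT `*` Y) = Q Y.
Proof.
move=> mY; rewrite glued_measureX// exchange_big/=.
have wT0 i j : (0 <= w^T i j)%R by rewrite mxE.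
have wTQ j : (\sum_i w^T j i = fine (Q (B j)))%R.
  by under eq_bigr do rewrite mxE.
have wTP i : (\sum_j w^T j i = fine (P (A i)))%R.
  by under eq_bigr do rewrite mxE.
have := @glued_marginal _ _ _ w^T _ (fun j => fine (Q (Y `&` B j))) _ wT0 wTQ wTP.
move=> glued; rewrite -[RHS]fineK ?fin_num_measure//.
rewrite -(sum_cells Q mB tB cB mY) -glued => [|j]; last first.
  rewrite fine_ge0//= fine_le ?fin_num_measure//; first exact: measurableI.
  by rewrite le_measure// inE//; exact: measurableI.
congr EFin; apply: eq_bigr => j _; apply: eq_bigr => i _.
by rewrite setTI mxE [(fine (P _) * fine (Q _))%R]mulrC [(fine (P _) * _)%R]mulrC.
Qed.

Lemma glued_measure_cell (i j : 'I_n.+1) :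
  glued_measure (A i `*` B j) = (w i j)%:E.
Proof.
rewrite glued_measureX//.
rewrite (bigD1 i)//= (bigD1 j)//= !setIid.
rewrite big1 => [|l lj]; last first.
  by rewrite (trivIsetP.1 tB) ?measure0 ?mulr0 ?mulr0//= eq_sym.
rewrite big1 ?addr0 => [|k ki]; last first.
  rewrite big1// => l _.
  by rewrite (trivIsetP.1 tA) ?measure0/= ?mul0r ?mulr0//= eq_sym.
congr EFin; have [pq0|pq0] := eqVneq (fine (P (A i)) * fine (Q (B j)))%R 0%R; last first.
  by rewrite divfK.
rewrite pq0 mulr0; apply/esym/eqP; rewrite eq_le w0 andbT.
move/eqP: pq0; rewrite mulf_eq0 => /orP[] /eqP <-.
  by rewrite -wP (bigD1 j)//= lerDl sumr_ge0.
by rewrite -wQ (bigD1 i)//= lerDl sumr_ge0.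
Qed.

End glue.

(** * Couplings on the Borel sets of the square *)

Lemma measurable_fun_generated d (T : measurableType d) (X : pointedType)
    (G : set (set X)) (f : T -> g_sigma_algebraType G) :
  (forall U, G U -> measurable (f @^-1` U)) -> measurable_fun [set: T] f.
Proof.
move=> mf; apply: (@measurability _ _ T (g_sigma_algebraType G) setT f G erefl).
by move=> _ [U GU <-]; rewrite setTI; exact: mf.
Qed.

Section couplings.
Context {R : realType} {S : completeMetricType R}.
Implicit Types (f : S -> R) (P Q : P1 S).

Lemma measurable_fst_borel :
  measurable_fun [set: borel (S * S)%type] (fst : borel (S * S)%type -> borel S).
Proof.
apply: measurable_fun_generated => U oU; apply: sub_sigma_algebra.
by apply: open_comp => // z _; exact: cvg_fst.
Qed.

Lemma measurable_snd_borel :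
  measurable_fun [set: borel (S * S)%type] (snd : borel (S * S)%type -> borel S).
Proof.
apply: measurable_fun_generated => U oU; apply: sub_sigma_algebra.
by apply: open_comp => // z _; exact: cvg_snd.
Qed.

Lemma mdist_continuous : continuous (fun z : S * S => mdist z.1 z.2 : R).
Proof.
move=> [x y]; apply/cvgrPdist_lt => e e0.
have e20 : (0 < e / 2)%R by rewrite divr_gt0.
exists (ball x (e / 2)%R, ball y (e / 2)%R).
  by split; exact: nbhsx_ballx.
move=> [x' y'] [/=]; rewrite !ballEmdist/= => xx' yy'.
have := metric_triangle x x' y; have := metric_triangle x' y' y.
have := metric_triangle x' x y'; have := metric_triangle x y y'.
rewrite (metric_sym x' x) (metric_sym y' y) => *.
by rewrite ltr_norml; apply/andP; split; lra.
Qed.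

Lemma measurable_mdist :
  measurable_fun [set: borel (S * S)%type]
    (fun z : borel (S * S)%type => (mdist z.1 z.2)%:E).
Proof.
apply/measurable_EFinP.
apply: measurable_generated_real => U oU.
by have /continuousP := mdist_continuous; apply.
Qed.

Lemma open_mball (x : S) (r : R) : open (ball x r).
Proof.
have /continuousP/(_ _ (@open_lt R r)) := kappa_continuous (kappa_mdist x).
by congr open; apply/seteqP; split=> y /=; rewrite ballEmdist/= metric_sym.
Qed.

(** By separability an open subset of the square is a countable union of
    rectangles, namely of products of balls with centers in a countable dense
    set and inverse integer radii. Hence a measure on the product
    sigma-algebra, such as a glued measure, restricts to a Borel measure. *)
Lemma measurable_borel_prod : separable S ->
  measurable_fun [set: (borel S * borel S)%type]
    (fun z => z : borel (S * S)%type).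
Proof.
move=> /separable_dense_seq[a a_dense].
apply: measurable_fun_generated => U oU.
pose rect (t : nat * nat * nat) : set (borel S * borel S) :=
  ball (a t.1.1) t.2.+1%:R^-1 `*` ball (a t.1.2) t.2.+1%:R^-1.
have -> : (fun z => z) @^-1` U = \bigcup_(t in [set t | rect t `<=` U]) rect t.
  apply/seteqP; split=> [[x y] /= Uxy|z [t tU /tU//]].
  have [[V W] /= [/nbhs_ballP[r /= r0 rV] /nbhs_ballP[s /= s0 sW]] VWU] :=
    open_nbhs_nbhs (conj oU Uxy).
  have [m [m0 mr ms]] : exists m : R, [/\ (0 < m)%R, (m <= r)%R & (m <= s)%R].
    by exists (Num.min r s); rewrite lt_min r0 s0 !ge_min !lexx orbT.
  have m20 : (0 < m / 2)%R by rewrite divr_gt0.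
  have [k] := ltr_add_invr m20; rewrite add0r => km.
  have k0 : (0 < k.+1%:R^-1 :> R)%R by [].
  have [i xi] := a_dense x _ k0; have [j yj] := a_dense y _ k0.
  exists (i, j, k); last by split=> /=; rewrite ballEmdist/= metric_sym.
  move=> [x' y'] [/=]; rewrite !ballEmdist/= => ix' jy'.
  apply: VWU; split; [apply: rV|apply: sW]; rewrite ballEmdist/=.
    have := lt_trans xi km; have := lt_trans ix' km.
    by have := metric_triangle x (a i) x'; lra.
  have := lt_trans yj km; have := lt_trans jy' km.
  by have := metric_triangle y (a j) y'; lra.
rewrite bigcup_mkcond; apply: countable_bigcupT_measurable => // t.
case: ifPn => // _; apply: measurableX; apply: sub_sigma_algebra;
  exact: open_mball.
Qed.
End couplings.

Section probability_of_measure.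
Context {d : measure_display} {T : measurableType d} {R : realType}.
Variables (mu : measure T R) (mu1 : mu setT = 1).

(** A copy of [mu] indexed by the proof of [mu1], so that the probability
    structure is attached to this copy and not to every measure. *)
Definition unit_mass_measure of mu setT = 1 : set T -> \bar R := mu.

HB.instance Definition _ := Measure.on (unit_mass_measure mu1).
HB.instance Definition _ :=
  Measure_isProbability.Build _ _ _ (unit_mass_measure mu1) mu1.

Definition probability_of_measure : probability T R := unit_mass_measure mu1.

End probability_of_measure.

Section image_measure.
Context {R : realType} {d1 d2 : measure_display}.
Context {T1 : measurableType d1} {T2 : measurableType d2}.
Variables (mu : measure T1 R) (nu : measure T2 R) (phi : T1 -> T2).
Hypothesis mphi : measurable_fun [set: T1] phi.
Hypothesis mu_phi : forall A, measurable A -> mu (phi @^-1` A) = nu A.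

Lemma ge0_integral_image (g : T2 -> \bar R) :
  measurable_fun [set: T2] g -> (forall y, 0 <= g y) ->
  \int[mu]_x g (phi x) = \int[nu]_y g y.
Proof.
move=> mg g0.
have := @ge0_integral_pushforward _ _ _ _ _ phi mphi mu setT g measurableT mg
  (fun y _ => g0 y).
rewrite preimage_setT => <-.
by apply: eq_measure_integral => A mA _; exact: mu_phi.
Qed.

Lemma integrable_image (g : T2 -> \bar R) :
  nu.-integrable [set: T2] g -> mu.-integrable [set: T1] (g \o phi).
Proof.
move=> /integrableP[mg ig]; apply/integrableP; split.
  exact: measurableT_comp.
rewrite (ge0_integral_image (g := abse \o g)) => [//||y]; last exact: abse_ge0.
exact: measurableT_comp.
Qed.

Lemma integral_image (g : T2 -> \bar R) : nu.-integrable [set: T2] g ->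
  \int[mu]_x g (phi x) = \int[nu]_y g y.
Proof.
move=> ig; have /integrableP[mg _] := ig.
have := @integral_pushforward _ _ _ _ _ phi mphi mu setT g mg
  (integrable_image ig) measurableT.
rewrite preimage_setT => <-.
by apply: eq_measure_integral => A mA _; exact: mu_phi.
Qed.

End image_measure.

Section wasserstein_bounds.
Context {R : realType} {S : completeMetricType R}.
Implicit Types (f : S -> R) (P Q : P1 S).

(** The easy half of Kantorovich duality: for a coupling [pi], the difference of
    the means of [f] is the integral of [f z.1 - f z.2] against [pi]. *)
Lemma mean_dist_le_wasserstein f P Q : kappa S f ->
  `|mean f P - mean f Q|%:E <= wasserstein P Q.
Proof.
move=> f_kappa; apply: le_ereal_inf_tmp => _ [pi [piP piQ] <-].
have iP := kappa_integrable P f_kappa; have iQ := kappa_integrable Q f_kappa.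
have i1 := integrable_image measurable_fst_borel piP iP.
have i2 := integrable_image measurable_snd_borel piQ iQ.
rewrite -abse_EFin EFinB !mean_EFin//.
rewrite -(integral_image measurable_fst_borel piP iP).
rewrite -(integral_image measurable_snd_borel piQ iQ).
have i12 := integrableB measurableT i1 i2; have /integrableP[m12 _] := i12.
rewrite -integralB//; apply: le_trans (le_abse_integral _ measurableT m12) _.
apply: ge0_le_integral => //.
- exact: (measurableT_comp _ m12).
- exact: measurable_mdist.
- by move=> z _ /=; rewrite lee_fin.
Qed.

Hypothesis sepS : separable S.

(** The Borel version of the gluing: the glued measure is transported along the
    identity, from the product sigma-algebra to the Borel sets of the
    square. *)
Lemma coupling_of_cells P Q (n : nat) (A : nat -> set (borel S))
    (w : 'M[R]_n.+1) :
  (forall i, measurable (A i)) -> trivIset [set: nat] A ->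
  \big[setU/set0]_(i < n.+1) A i = setT ->
  (forall i j, 0 <= w i j)%R ->
  (forall i, \sum_j w i j = fine (P (A i)))%R ->
  (forall j, \sum_i w i j = fine (Q (A j)))%R ->
  exists2 pi, coupling P Q pi &
    forall i j : 'I_n.+1, pi (A i `*` A j) = (w i j)%:E.
Proof.
move=> mA tA cA w0 wP wQ.
pose incl (z : (borel S * borel S)%type) : borel (S * S)%type := z.
(* Typing the image measure abstracts [mu_of] over a proof that [incl] is
   measurable. *)
pose mu_of : measure (borel (S * S)%type) R :=
  pushforward (glued_measure P Q mA mA w0) incl.
pose mu := mu_of (measurable_borel_prod sepS).
have mu1 : mu setT = 1.
  rewrite -[RHS](@probability_setT _ _ _ P).
  by rewrite -(glued_measure_fst mA mA tA cA w0 wP wQ measurableT) setXTT.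
exists (probability_of_measure mu1); last first.
  by move=> i j; rewrite -(glued_measure_cell mA mA tA tA w0 wP wQ i j).
split=> X mX.
  by rewrite -(glued_measure_fst mA mA tA cA w0 wP wQ mX) setXT.
by rewrite -(glued_measure_snd mA mA tA cA w0 wP wQ mX) setTX.
Qed.

Lemma integrable_scaled_indic d (T : measurableType d) (mu : probability T R)
    (c : R) (B : set T) : measurable B ->
  mu.-integrable [set: T] (fun x => (c * \1_B x)%R%:E).
Proof.
move=> mB; have B_int : mu.-integrable [set: T] (fun x => (\1_B x)%:E).
  exact: integrable_indic.
by under eq_fun do rewrite EFinM; exact: integrableZl.
Qed.

Lemma integral_step d (T : measurableType d) (mu : probability T R)
    (I : finType) (c : I -> R) (B : I -> set T) :
  (forall i, measurable (B i)) ->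
  \int[mu]_x (\sum_i (c i * \1_(B i) x)%R%:E) =
  \sum_i (c i)%:E * mu (B i).
Proof.
move=> mB.
rewrite integral_sum//; last first.
  by move=> i; exact: (integrable_scaled_indic mu (c i) (mB i)).
apply: eq_bigr => i _; under eq_integral do rewrite EFinM.
by rewrite integralZl ?integral_indic ?setIT//; exact: (integrable_indic mu (mB i)).
Qed.

Lemma sum_indic_disjoint (I : finType) (T : Type) (c : I -> R) (B : I -> set T) i x :
  (forall j, B j x -> j = i) -> B i x ->
  (\sum_j (c j * \1_(B j) x)%R%:E) = (c i)%:E.
Proof.
move=> Buniq Bix; rewrite (bigD1 i)//= indicE mem_set// mulr1.
rewrite big1 ?adde0// => j ji; rewrite indicE memNset ?mulr0//.
by move=> /Buniq/eqP; apply/negP.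
Qed.

Section cells.
Variables (n : nat) (a : 'I_n.+1 -> S) (A : nat -> set (borel S)).
Hypothesis mA : forall i, measurable (A i).
Hypothesis tA : trivIset [set: nat] A.
Hypothesis cA : \big[setU/set0]_(i < n.+1) A i = setT.
Hypothesis nearA : forall (i : 'I_n.+1) x, A i x -> mdist x (a i) = dist_to a x.

Lemma cell_exists x : exists i : 'I_n.+1, A i x.
Proof.
have : (\big[setU/set0]_(i < n.+1) A i) x by rewrite cA.
by rewrite -bigcup_mkord => -[i /= ni Aix]; exists (Ordinal ni).
Qed.

Lemma cell_uniq (i j : 'I_n.+1) x : A i x -> A j x -> i = j.
Proof. by move=> Ai Aj; apply/val_inj/(tA I I); exists x. Qed.

(** The left-hand side is the mean of the function equal to [f (a i)] on the cell
    [A i], which exceeds [f] by at most the distance to the nearest point. *)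
Lemma cell_mean_le f P : kappa S f ->
  (\sum_(i < n.+1) f (a i) * fine (P (A i)) <=
   mean f P + mean (dist_to a) P)%R.
Proof.
move=> f_kappa; have D_kappa : kappa S (dist_to a) by exact: mcshane_kappa.
rewrite -lee_fin EFinD !mean_EFin// -sumEFin.
under eq_bigr do rewrite EFinM fineK ?fin_num_measure//.
rewrite -(integral_step P _ (fun i : 'I_n.+1 => mA i)).
have f_int := kappa_integrable P f_kappa.
have D_int := kappa_integrable P D_kappa.
rewrite -(integralD measurableT f_int D_int).
apply: le_integral => //.
- apply: integrable_sum => // i _.
  exact: (integrable_scaled_indic P (f (a i)) (mA i)).
- exact: integrableD.
move=> x _; have [i Aix] := cell_exists x.
have Ax_uniq (j : 'I_n.+1) : A j x -> j = i.
  by move=> Ajx; exact: cell_uniq Ajx Aix.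
rewrite (sum_indic_disjoint _ Ax_uniq Aix).
rewrite /= -EFinD lee_fin -(nearA Aix) metric_sym; exact: kappa_le.
Qed.

(** In the glued coupling, moving [x] to [y] costs at most the cost of moving
    the nearest point of [x] to that of [y], plus the distances of [x] and [y]
    to their nearest points. *)
Lemma wasserstein_le_cells P Q (w : 'M[R]_n.+1) :
  (forall i j, 0 <= w i j)%R ->
  (forall i, \sum_j w i j = fine (P (A i)))%R ->
  (forall j, \sum_i w i j = fine (Q (A j)))%R ->
  wasserstein P Q <= (\sum_i \sum_j mdist (a i) (a j) * w i j +
    mean (dist_to a) P + mean (dist_to a) Q)%:E.
Proof.
move=> w0 wP wQ; have D_kappa : kappa S (dist_to a) by exact: mcshane_kappa.
have [pi pi_coupling piA] := coupling_of_cells mA tA cA w0 wP wQ.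
have [piP piQ] := pi_coupling.
apply: le_trans (ereal_inf_lbound _) _; first by exists pi.
pose c (ij : 'I_n.+1 * 'I_n.+1) : R := mdist (a ij.1) (a ij.2).
pose AA (ij : 'I_n.+1 * 'I_n.+1) : set (borel (S * S)%type) :=
  A ij.1 `*` A ij.2.
have mAA ij : measurable (AA ij).
  have := measurable_fst_borel measurableT (mA ij.1).
  have := measurable_snd_borel measurableT (mA ij.2).
  by rewrite !setTI => mA2 mA1; exact: measurableI mA1 mA2.
have D_meas : measurable_fun [set: borel S] (EFin \o (dist_to a : borel S -> R)).
  by apply/measurable_EFinP; exact: kappa_measurable.
have D1_meas := measurableT_comp D_meas measurable_fst_borel.
have D2_meas := measurableT_comp D_meas measurable_snd_borel.
have step_meas : measurable_fun [set: borel (S * S)%type]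
    (fun z => \sum_ij (c ij * \1_(AA ij) z)%R%:E).
  apply: emeasurable_sum => ij; apply/measurable_EFinP.
  by apply: measurable_funM => //; exact: measurable_indic.
have D_ge0 (x : S) : 0 <= (dist_to a x)%:E by rewrite lee_fin dist_to_ge0.
have step_ge0 z : 0 <= \sum_ij (c ij * \1_(AA ij) z)%R%:E.
  by apply: sume_ge0 => ij _; rewrite lee_fin mulr_ge0// mdist_ge0.
apply: (@le_trans _ _ (\int[pi]_z ((\sum_ij (c ij * \1_(AA ij) z)%R%:E) +
    (dist_to a z.1)%:E + (dist_to a z.2)%:E))).
  apply: ge0_le_integral => //.
  - by move=> z _; rewrite lee_fin mdist_ge0.
  - exact: measurable_mdist.
  - by apply: emeasurable_funD => //; exact: emeasurable_funD.
  move=> [x y] _; have [i Aix] := cell_exists x; have [j Ajy] := cell_exists y.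
  have AA_uniq kl : AA kl (x, y) -> kl = (i, j).
    case: kl => k l [/= Akx Aly].
    by rewrite (cell_uniq Akx Aix) (cell_uniq Aly Ajy).
  have AAxy : AA (i, j) (x, y) by [].
  rewrite (sum_indic_disjoint _ AA_uniq AAxy).
  rewrite -!EFinD lee_fin/= -(nearA Aix) -(nearA Ajy).
  have := metric_triangle x (a i) y; have := metric_triangle (a i) (a j) y.
  by rewrite (metric_sym (a j) y) /c/=; lra.
rewrite ge0_integralD//; last 2 first.
- by move=> z _; rewrite adde_ge0.
- exact: emeasurable_funD.
rewrite ge0_integralD// (integral_step pi)//.
have -> : \int[pi]_z (dist_to a z.1)%:E = (mean (dist_to a) P)%:E.
  by rewrite mean_EFin//; exact: (ge0_integral_image measurable_fst_borel piP D_meas).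
have -> : \int[pi]_z (dist_to a z.2)%:E = (mean (dist_to a) Q)%:E.
  by rewrite mean_EFin//; exact: (ge0_integral_image measurable_snd_borel piQ D_meas).
rewrite !EFinD !leeD2r// pair_bigA/= -sumEFin.
by apply: lee_sum => -[i j] _; rewrite /= piA EFinM.
Qed.

End cells.
End wasserstein_bounds.

(** * Kantorovich-Rubinstein duality *)

Section kantorovich_rubinstein.
Context {R : realType} {S : completeMetricType R}.
Implicit Types (f g : S -> R) (P Q : P1 S).

(** Voronoi cells, with ties resolved in favour of the smallest index. *)
Lemma nearest_cells (n : nat) (a : 'I_n.+1 -> S) :
  exists A : nat -> set (borel S),
    [/\ forall i, measurable (A i), trivIset [set: nat] A,
        \big[setU/set0]_(i < n.+1) A i = setT &
        forall (i : 'I_n.+1) x, A i x -> mdist x (a i) = dist_to a x].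
Proof.
pose F (k : nat) : set (borel S) :=
  [set x | mdist x (a (inord k)) <= dist_to a x]%R.
have mF k : measurable (F k).
  have mD : measurable_fun [set: borel S]
      (fun x : borel S => mdist x (a (inord k)) - dist_to a x)%R.
    apply: measurable_funB; first exact: (kappa_measurable (kappa_mdist _)).
    by apply: kappa_measurable; exact: mcshane_kappa.
  have := mD measurableT _ (@measurable_itv R `]-oo, (0 : R)%R]%O); rewrite setTI.
  congr measurable; apply/seteqP.
  by split=> x; rewrite /F /= in_itv/= subr_le0.
exists (seqDU F); split.
- exact: seqDU_measurable.
- exact: trivIset_seqDU.
- rewrite -bigsetU_seqDU -bigcup_mkord -subTset => x _.
  have [i xi] := dist_to_attained a x.
  by exists (i : nat); [exact: ltn_ord|rewrite /F /= inord_val xi].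
move=> i x Aix; have := subset_seqDU Aix; rewrite /F /= inord_val => xi.
by apply/eqP; rewrite eq_le xi dist_to_le.
Qed.

(** Duality up to the discretization error: the finite duality is applied to the
    masses of the Voronoi cells of [P] and [Q]. *)
Lemma wasserstein_le_mean_dist (n : nat) (a : 'I_n.+1 -> S) P Q (e : R) :
  separable S -> (0 < e)%R ->
  exists2 f, kappa S f &
    wasserstein P Q <= (mean f P - mean f Q +
      2 * (mean (dist_to a) P + mean (dist_to a) Q) + e)%:E.
Proof.
move=> sepS e0; have [A [mA tA cA nearA]] := nearest_cells a.
pose p (i : 'I_n.+1) := fine (P (A i)); pose q (i : 'I_n.+1) := fine (Q (A i)).
have p1 : (\sum_i p i = 1)%R.
  have := sum_cells P mA tA cA measurableT; rewrite probability_setT /= => <-.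
  by under [RHS]eq_bigr do rewrite setTI.
have q1 : (\sum_i q i = 1)%R.
  have := sum_cells Q mA tA cA measurableT; rewrite probability_setT /= => <-.
  by under [RHS]eq_bigr do rewrite setTI.
have p0 i : (0 <= p i)%R by rewrite fine_ge0.
have q0 i : (0 <= q i)%R by rewrite fine_ge0.
have [w [phi [psi [w0 wP wQ phi_psi w_opt]]]] := finite_kantorovich_duality
  p0 q0 p1 q1 (\matrix_(i, j) mdist (a i) (a j))%R e0.
(* By the constraint on [phi] and [psi], this contraction satisfies
   [phi i <= f (a i)] and [psi j <= - f (a j)]: a single function replaces the
   pair of potentials without lowering the dual value. *)
pose f := mcshane a (fun j => - psi j)%R.
have f_kappa : kappa S f by exact: mcshane_kappa.
exists f => //.
have W_le := wasserstein_le_cells sepS mA tA cA nearA w0 wP wQ.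
rewrite (le_trans W_le)// lee_fin.
have phi_le i : (phi i <= f (a i))%R.
  apply: mcshane_ge => j.
  by have := phi_psi i j; rewrite mxE => ?; lra.
have psi_le j : (psi j <= - f (a j))%R.
  by have := mcshane_le a (fun j => - psi j)%R (a j) j; rewrite mdistxx -/f; lra.
have fP := cell_mean_le mA tA cA nearA P f_kappa.
have := cell_mean_le mA tA cA nearA Q (kappaN f_kappa); rewrite meanN//.
move: w_opt; under eq_bigr do under eq_bigr do rewrite mxE.
have : (\sum_i phi i * p i <= \sum_(i < n.+1) f (a i) * fine (P (A i)))%R.
  by apply: ler_sum => i _; rewrite ler_wpM2r.
have : (\sum_i psi i * q i <= \sum_(i < n.+1) - f (a i) * fine (Q (A i)))%R.
  by apply: ler_sum => i _; rewrite ler_wpM2r.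
by lra.
Qed.

Lemma fine_dense_points (a : nat -> S) P (e : R) :
  (forall (x : S) (d : R), (0 < d)%R -> exists i, (mdist x (a i) < d)%R) ->
  (0 < e)%R ->
  \forall n \near \oo, (mean (dist_to (fun i : 'I_n.+1 => a i)) P < e)%R.
Proof.
move=> a_dense e0; have /cvgrPdist_lt/(_ e e0) := mean_dist_to_cvg0 P a_dense.
apply: filterS => n; rewrite sub0r normrN; apply: le_lt_trans.
exact: ler_norm.
Qed.

(** The discretization error of [wasserstein_le_mean_dist] vanishes along a dense
    sequence, for [P] and [Q] simultaneously. *)
Theorem kantorovich_rubinstein P Q : separable S ->
  wasserstein P Q =
  ereal_sup [set `|mean f P - mean f Q|%:E | f in kappa S].
Proof.
move=> sepS; apply/eqP; rewrite eq_le; apply/andP; split; last first.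
  by apply: ge_ereal_sup => _ [f f_kappa <-]; exact: mean_dist_le_wasserstein.
have [a a_dense] := separable_dense_seq sepS.
apply/lee_addgt0Pr => e e0; have e8 : (0 < e / 8)%R by rewrite divr_gt0.
have [n _ /(_ n (leqnn n))[DP DQ]] := filterI (fine_dense_points P a_dense e8)
  (fine_dense_points Q a_dense e8).
have e2 : (0 < e / 2)%R by rewrite divr_gt0.
have [f f_kappa W_le] :=
  wasserstein_le_mean_dist (fun i : 'I_n.+1 => a i) P Q sepS e2.
apply: (@le_trans _ _ ((mean f P - mean f Q)%:E + e%:E)).
  by rewrite (le_trans W_le)// -EFinD lee_fin; lra.
rewrite leeD2r//; apply: (@le_trans _ _ `|mean f P - mean f Q|%:E).
  by rewrite lee_fin ler_norm.
by apply: ereal_sup_ubound; exists f.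
Qed.

End kantorovich_rubinstein.

(** * Testing with finitely many contractions *)

Section finite_reduction.
Context {R : realType} {S : completeMetricType R}.
Implicit Types (f g : S -> R) (P Q : P1 S).

Lemma lower_grid (M h : R) : (0 < h)%R ->
  exists (N : nat) (v : 'I_N -> R), forall u, (`|u| <= M)%R ->
    exists k, (v k <= u <= v k + h)%R.
Proof.
move=> h0; have /andP[_] := truncn_itv (normr_ge0 (M / h)%R).
set K := (Num.truncn _).+1 => MK.
have {}MK : (M < K%:R * h)%R.
  by rewrite -ltr_pdivrMr// (le_lt_trans (ler_norm _)).
exists (2 * K).+1, (fun k => (k%:R - K%:R) * h)%R => u.
rewrite ler_norml => /andP[uM1 uM2].
pose t := (u / h + K%:R)%R.
have t0 : (0 <= t)%R.
  by rewrite /t -lerBlDr sub0r ler_pdivlMr// mulNr; lra.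
have /andP[kt tk] := truncn_itv t0.
have kK : (Num.truncn t < (2 * K).+1)%N.
  rewrite ltnS -(ler_nat R) (le_trans kt)// natrM /t.
  by rewrite -lerBrDr ler_pdivrMr//; lra.
exists (Ordinal kK) => /=.
have -> : u = ((t - K%:R) * h)%R by rewrite /t addrK divfK// gt_eqF.
rewrite ler_pM2r// lerD2r kt/=.
move: tk; rewrite -natr1 => /ltW tk.
by rewrite -[X in (_ <= _ + X)%R]mul1r -mulrDl ler_pM2r//; lra.
Qed.

(** The finitely many tests depend on [P] and [e] but not on [Q]. Choose points
    whose mean distance under [P] is small. Replacing [g] by the McShane
    extension of its restriction to these points can only increase the mean
    under [Q], whatever [Q] is, while the mean under [P] grows by little. After
    subtracting a constant from [g], the values at the points are bounded by
    their mutual distances; rounding them down to a grid leaves finitely many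
    extensions. Applied to [g] and to [- g], this bounds the absolute value,
    with factor 1. *)
Lemma finite_testing P (e : R) : separable S -> (0 < e)%R ->
  exists (I : finType) (f : I -> S -> R), (forall k, kappa S (f k)) /\
    forall g Q, kappa S g -> exists k,
      (`|mean g P - mean g Q| <= `|mean (f k) P - mean (f k) Q| + e)%R.
Proof.
move=> sepS e0; have [a' a_dense] := separable_dense_seq sepS.
have e8 : (0 < e / 8)%R by rewrite divr_gt0.
have [n _ /(_ n (leqnn n))] := fine_dense_points P a_dense e8.
set a : 'I_n.+1 -> S := fun i => a' i => DP.
have D_kappa : kappa S (dist_to a) by exact: mcshane_kappa.
pose h := (e / 2)%R; have h0 : (0 < h)%R by rewrite /h divr_gt0.
pose M := (\sum_i mdist (a i) (a ord0))%R.
have [N [v v_grid]] := lower_grid M h0.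
exists {ffun 'I_n.+1 -> 'I_N}, 
  (fun k : {ffun 'I_n.+1 -> 'I_N} => mcshane a (v \o k)).
split=> [k|]; first exact: mcshane_kappa.
(* The one-sided estimate, with the test independent of [Q] *)
have testing g : kappa S g -> exists k : {ffun 'I_n.+1 -> 'I_N}, forall Q,
    (mean g Q - mean g P <=
     mean (mcshane a (v \o k)) Q - mean (mcshane a (v \o k)) P + e)%R.
  move=> g_kappa; pose g0 x := (g x - g (a ord0))%R.
  have g0_kappa : kappa S g0 by exact: kappa_sub_cst.
  have g0_le i : (`|g0 (a i)| <= M)%R.
    rewrite (le_trans (g_kappa _ _))// /M (bigD1 i)//= lerDl.
    by apply: sumr_ge0 => j _; exact: mdist_ge0.
  have /choice[k kP] : forall i, exists k, (v k <= g0 (a i) <= v k + h)%R.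
    by move=> i; exact: v_grid.
  exists [ffun i => k i] => Q; set m := mcshane _ _.
  have m_kappa : kappa S m by exact: mcshane_kappa.
  have -> : (mean g Q - mean g P = mean g0 Q - mean g0 P)%R.
    by rewrite !mean_sub_cst//; lra.
  have g0_le_m : (mean g0 Q <= mean m Q + 0 * mean m Q + h)%R.
    apply: mean_le => // x; rewrite mul0r addr0.
    rewrite (le_trans (kappa_le_mcshane a x g0_kappa))//.
    by apply: mcshane_perturb => i; rewrite /= ffunE; have /andP[] := kP i.
  have m_le_g0 : (mean m P <= mean g0 P + 2 * mean (dist_to a) P + 0)%R.
    apply: mean_le => // x; rewrite addr0.
    rewrite (le_trans _ (mcshane_le_kappa a x g0_kappa))//.
    rewrite -[leRHS]addr0; apply: mcshane_perturb => i.
    by rewrite /= ffunE addr0; have /andP[] := kP i.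
  by move: g0_le_m m_le_g0; rewrite /h mul0r !addr0; lra.
move=> g Q g_kappa; have [k kQ] := testing g g_kappa.
have [l lQ] := testing _ (kappaN g_kappa).
have [gPQ|gPQ] := leP (mean g P) (mean g Q).
  exists k; rewrite distrC ger0_norm ?subr_ge0//.
  by rewrite (le_trans (kQ Q))// lerD2r distrC ler_norm.
exists l; rewrite ger0_norm ?subr_ge0; last exact: ltW.
have -> : (mean g P - mean g Q =
    mean (fun x => - g x) Q - mean (fun x => - g x) P)%R.
  by rewrite !meanN//; lra.
by apply: (le_trans (lQ Q)); rewrite lerD2r distrC ler_norm.
Qed.

End finite_reduction.

(** * Nets and approach structures *)

Section nets.
Context {R : realType} {I : Type} (le : I -> I -> Prop).
Implicit Types u v : I -> \bar R.

Lemma le_limsup_net u v : (forall i, u i <= v i) ->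
  limsup_net le u <= limsup_net le v.
Proof.
move=> uv; apply: le_ereal_inf_tmp => _ [i _ <-].
apply: le_trans (ereal_inf_lbound _) _; first by exists i.
apply: ge_ereal_sup => _ [j ij <-]; rewrite (le_trans (uv j))//.
by apply: ereal_sup_ubound; exists j.
Qed.

Lemma limsup_net_lt u r : limsup_net le u < r ->
  exists i, forall j, le i j -> u j < r.
Proof.
move=> /ereal_inf_lt[_ [i _ <-] ir]; exists i => j ij.
by apply: le_lt_trans ir; apply: ereal_sup_ubound; exists j.
Qed.

Lemma limsup_net_le u r i : (forall j, le i j -> u j <= r) ->
  limsup_net le u <= r.
Proof.
move=> ur; apply: le_trans (ereal_inf_lbound _) _; first by exists i.
by apply: ge_ereal_sup => _ [j ij <-]; exact: ur.
Qed.

Lemma limsup_net_ge0 u : directed le -> (forall i, 0 <= u i) ->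
  0 <= limsup_net le u.
Proof.
move=> [_ le_refl _ _] u0; apply: le_ereal_inf_tmp => _ [i _ <-].
by apply: le_trans (u0 i) _; apply: ereal_sup_ubound; exists i => //=.
Qed.

Lemma directed_seq (T : eqType) (s : seq T) (f : T -> I) : directed le ->
  exists i, forall k, k \in s -> le (f k) i.
Proof.
move=> [[i0] _ le_trans le_ub]; elim: s => [|k s [i IHs]]; first by exists i0.
have [j [kj ij]] := le_ub (f k) i; exists j => l.
by rewrite inE => /predU1P[->//|/IHs /le_trans]; exact.
Qed.

End nets.

Lemma upwards_directed_seq (R : realType) (X : Type) (T : eqType)
    (A0 : set (X -> \bar R)) (s : seq T) (phi : T -> X -> \bar R) :
  upwards_directed A0 -> A0 !=set0 -> (forall k, A0 (phi k)) ->
  exists2 psi, A0 psi & forall k x, k \in s -> phi k x <= psi x.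
Proof.
move=> A_dir [psi0 A0psi0] A0phi; elim: s => [|k s [psi A0psi IHs]].
  by exists psi0.
have [chi A0chi chi_ge] := A_dir _ _ (A0phi k) A0psi; exists chi => // l x.
have := chi_ge x; rewrite ge_max inE => /andP[phi_chi psi_chi].
by move=> /predU1P[->//|/IHs]; move/(_ x)/le_trans; exact.
Qed.

(** The Wasserstein structure makes the mean maps contractive and satisfies the
    approach axioms, its triangle inequality coming from the duality formula;
    so it contains the weakest such structure. Conversely, by [finite_testing]
    the distance to [P] is dominated, up to [e], by a finite maximum of members
    of the contractive structure at [P], and functional ideals are closed under
    such domination. *)
Theorem wasserstein_structureE (R : realType) (S : completeMetricType R) :
  separable S -> contractive_structure S = wasserstein_structure S.
Proof.
move=> sepS; have [kA k_contr k_weakest] := contractive_structureP S.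
have W_ge0 P Q : 0 <= wasserstein P Q.
  apply: le_ereal_inf_tmp => _ [pi _ <-]; apply: integral_ge0 => z _.
  by rewrite lee_fin mdist_ge0.
have W_approach : approach_structure (wasserstein_structure S).
  apply: metric_structure_approach => // [P|P Q T].
    apply/eqP; rewrite eq_le W_ge0 andbT kantorovich_rubinstein//.
    by apply: ge_ereal_sup => _ [f _ <-]; rewrite subrr normr0.
  rewrite (kantorovich_rubinstein P T sepS).
  apply: ge_ereal_sup => _ [f f_kappa <-].
  apply: (@le_trans _ _ (`|mean f P - mean f Q|%:E + `|mean f Q - mean f T|%:E)).
    by rewrite -EFinD lee_fin ler_distD.
  by apply: leeD; exact: mean_dist_le_wasserstein.
apply/funext => P; apply/seteqP; split.
  apply: k_weakest => // f f_kappa Q phi phi_le T /=.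
  have /andP[-> phi_le_dist] /= := phi_le (mean f T).
  exact: le_trans phi_le_dist (mean_dist_le_wasserstein _ _ f_kappa).
move=> phi phi_le; have [ideal _ _] := kA; have [_ kP_dir kP_closed] := ideal P.
apply: kP_closed => [Q|e o e0]; first by have /andP[] := phi_le Q.
have [I [f [f_kappa f_test]]] := finite_testing P sepS e0.
pose dist_mean (g : S -> R) Q := `|mean g P - mean g Q|%:E.
have dist_mean_in g : kappa S g -> contractive_structure S P (dist_mean g).
  move=> g_kappa; apply: (k_contr g g_kappa P (euclidean (mean g P))) => y.
  by rewrite lexx lee_fin normr_ge0.
have kP_neq0 : contractive_structure S P !=set0.
  exists (dist_mean (fun=> 0%R)); apply: dist_mean_in => x y.
  by rewrite subrr normr0 mdist_ge0.
have [psi kP_psi psi_ge] := upwards_directed_seq (enum I) kP_dir kP_neq0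
  (fun k => dist_mean_in _ (f_kappa k)).
exists psi => // Q; rewrite ge_min; apply/orP; left.
have /andP[_ phi_le_W] := phi_le Q; apply: le_trans phi_le_W _.
rewrite kantorovich_rubinstein//; apply: ge_ereal_sup => _ [g g_kappa <-].
have [k gk] := f_test g Q g_kappa.
apply: (@le_trans _ _ (dist_mean (f k) Q + e%:E)); first by rewrite -EFinD lee_fin.
by rewrite leeD2r// psi_ge// mem_enum.
Qed.

(** Up to [e] the supremum over all contractions is a maximum of finitely many
    terms, and in a directed set finitely many eventual bounds hold
    simultaneously from some index on. *)
Theorem limsup_ereal_sup_kappa (R : realType) (S : completeMetricType R)
    (I : Type) (le : I -> I -> Prop) (P_ : I -> P1 S) (P : P1 S) :
  separable S -> directed le ->
  ereal_sup [set limsup_net le (fun i => `|mean f P - mean f (P_ i)|%:E) |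
             f in kappa S] =
  limsup_net le (fun i =>
    ereal_sup [set `|mean f P - mean f (P_ i)|%:E | f in kappa S]).
Proof.
move=> sepS le_dir; apply/eqP; rewrite eq_le; apply/andP; split.
  apply: ge_ereal_sup => _ [f f_kappa <-]; apply: le_limsup_net => i.
  by apply: ereal_sup_ubound; exists f.
set L := ereal_sup _.
have limsup_le f : kappa S f ->
    limsup_net le (fun i => `|mean f P - mean f (P_ i)|%:E) <= L.
  by move=> f_kappa; apply: ereal_sup_ubound; exists f.
have L0 : 0 <= L.
  apply: le_trans (limsup_le (fun=> 0%R) _).
    by apply: limsup_net_ge0 => // i; rewrite lee_fin.
  by move=> x y; rewrite subrr normr0 mdist_ge0.
have [->|Loo] := eqVneq L +oo; first exact: leey.
have L_fin : L \is a fin_num by rewrite ge0_fin_numE// ltey.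
apply/lee_addgt0Pr => e e0; have e20 : (0 < e / 2)%R by rewrite divr_gt0.
have [K [f [f_kappa f_test]]] := finite_testing P sepS e20.
have L_lt : L < L + (e / 2)%:E by rewrite lteDl// lte_fin.
have /choice[i0 i0P] : forall k, exists i, forall j, le i j ->
    `|mean (f k) P - mean (f k) (P_ j)|%:E < L + (e / 2)%:E.
  by move=> k; apply: limsup_net_lt; exact: le_lt_trans (limsup_le _ _) L_lt.
have [i i_ge] := directed_seq (enum K) i0 le_dir.
apply: (@limsup_net_le _ _ _ _ _ i) => j ij.
apply: ge_ereal_sup => _ [g g_kappa <-].
have [k gk] := f_test g (P_ j) g_kappa.
have kj : le (i0 k) j.
  by have [_ _ le_trans _] := le_dir; apply: le_trans (i_ge k _) ij; rewrite mem_enum.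
rewrite [e]splitr EFinD addeA.
apply: (@le_trans _ _ (`|mean (f k) P - mean (f k) (P_ j)|%:E + (e / 2)%:E)).
  by rewrite -EFinD lee_fin.
by rewrite leeD2r// ltW// i0P.
Qed.

Theorem theorem3p3 (R : realType) (S : completeMetricType R)
    (sepS : separable S) :
  contractive_structure S = wasserstein_structure S /\
  (forall (I : Type) (le : I -> I -> Prop) (P_ : I -> P1 S) (P : P1 S),
     directed le ->
     limit_operator (contractive_structure S) le P_ P =
     limit_operator (wasserstein_structure S) le P_ P) /\
  (forall (I : Type) (le : I -> I -> Prop) (P_ : I -> P1 S) (P : P1 S),
     directed le ->
     ereal_sup [set limsup_net le
                      (fun i => `|mean f P - mean f (P_ i)|%:E) |
                f in kappa S] =
     limsup_net le (fun i =>
       ereal_sup [set `|mean f P - mean f (P_ i)|%:E | f in kappa S])).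
Proof.
have E := wasserstein_structureE sepS; split=> //; split=> I le P_ P le_dir.
  by rewrite E.
exact: limsup_ereal_sup_kappa.
Qed.
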